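(* There exists a unique pair $(\mathbf u_{\mathcal D},\boldsymbol\lambda_{\mathcal D})\in \mathbf U_{0,\mathcal D}\times \mathbf C_{\mathcal D}$ such that, for all $(\mathbf v_{\mathcal D},\boldsymbol\mu_{\mathcal D})\in \mathbf U_{0,\mathcal D}\times \mathbf C_{\mathcal D}$, $$\int_\Omega \boldsymbol\sigma_{\mathcal D}(\mathbf u_{\mathcal D}):\boldsymbol\varepsilon_{\mathcal D}(\mathbf v_{\mathcal D}) + S_{\mu,\lambda,\mathcal D}(\mathbf u_{\mathcal D},\mathbf v_{\mathcal D}) + \int_\Gamma \boldsymbol\lambda_{\mathcal D}\cdot[\![\mathbf v_{\mathcal D}]\!]_{\mathcal D} = \int_\Omega \mathbf f\cdot\widetilde\Pi^{\mathcal D}\mathbf v_{\mathcal D},$$ $$\int_\Gamma (\boldsymbol\mu_{\mathcal D}-\boldsymbol\lambda_{\mathcal D})\cdot[\![\mathbf u_{\mathcal D}]\!]_{\mathcal D}\le 0.$$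
   Context: Geometry. $d\in\{2,3\}$; $\Omega\subset\mathbb R^d$ is a bounded polyhedral domain; $\Gamma$ is a fracture network, $\overline\Gamma=\bigcup_{i\in I}\overline{\Gamma_i}$ ($I$ finite), each $\Gamma_i\subset\Omega$ being a polygonal simply connected open subdomain of a hyperplane of $\mathbb R^d$; fractures may only intersect at their boundaries, and $\Omega\setminus\Gamma$ is connected. The two sides of $\Gamma$ are denoted $\pm$, with unit normals $\mathbf n^\pm$ (constant on each $\Gamma_i$) oriented outward from the side $\pm$, so $\mathbf n^++\mathbf n^-=\mathbf 0$. Mesh. A polyhedral mesh of $\Omega$ with planar faces, conforming with $\Gamma$: $\mathcal M$, $\mathcal F$, $\mathcal V$, $\mathcal E$ are the finite sets of cells, faces, nodes, edges; $h_X$ and $|X|$ are the diameter and measure of $X$; $\mathbf x_s$ is the position of node $s$. There is $\mathcal F_\Gamma\subset\mathcal F$ with $\overline\Gamma=\bigcup_{\sigma\in\mathcal F_\Gamma}\overline\sigma$. $\mathcal F_K,\mathcal V_K$ are the faces and nodes of $K$, $\mathcal V_\sigma$ the nodes of $\sigma$, $\mathcal M_s$ the cells containing node $s$, $\mathcal V^{\rm ext}$ the nodes on $\partial\Omega$. $\mathbf n_{K\sigma}$ is the unit normal to $\sigma$ outward of $K$; an interior face between $K$ and $L$ is written $\sigma=K|L$, and if $\sigma\in\mathcal F_\Gamma$ the labels are chosen so that $\mathbf n_{K\sigma}=\mathbf n^+$, $\mathbf n_{L\sigma}=\mathbf n^-$. $\mathcal F^+_{\Gamma,K}=\{\sigma\in\mathcal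 F_\Gamma\cap\mathcal F_K:\mathbf n_{K\sigma}\cdot\mathbf n^+>0\}$. Mesh regularity: there is a matching simplicial submesh (each simplex is contained in a unique cell, each simplicial face is either disjoint from or contained in any given mesh face) and $\varrho\in(0,1)$ such that each simplex $\tau$ of the submesh has inradius $\ge\varrho h_\tau$, and $h_\tau\ge\varrho h_K$ whenever $\tau\subset K\in\mathcal M$. Displacement space. For a node $s$ and $K\in\mathcal M_s$, $\mathcal Ks$ is the set of cells of $\mathcal M_s$ on the same side of $\Gamma$ as $K$ (i.e. lying in the same local connected component of $\Omega\setminus\overline\Gamma$ near $s$; $\mathcal Ks=\mathcal M_s$ if $s\notin\overline\Gamma$). $\mathbf U_{0,\mathcal D}$ is the space of families $\mathbf v_{\mathcal D}=((\mathbf v_{\mathcal Ks})_{K\in\mathcal M,s\in\mathcal V_K},(\mathbf v_{K\sigma})_{K\in\mathcal M,\sigma\in\mathcal F^+_{\Gamma,K}})$ of vectors of $\mathbb R^d$ such that $\mathbf v_{\mathcal Ks}=0$ if $s\in\mathcal V^{\rm ext}$, and $\mathbf v_{\mathcal Ks}=\mathbf v_{\mathcal Ls}$ if $K,L\in\mathcal M_s$ are on the same side of $\Gamma$. Operators. Fix nonnegative weights with $\overline{\mathbf x}_\sigma=\sum_{s\in\mathcal V_\sigma}\omega_s^\sigma\mathbf x_s$, $\sum_s\omega_s^\sigma=1$, and $\overline{\mathbf x}_K=\sum_{s\in\mathcal V_K}\omega_s^K\mathbf x_s$, $\sum_s\omega^K_s=1$, where $\overline{\mathbf x}_\sigma,\overline{\mathbf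 x}_K$ are the centers of mass. Set $\overline{\mathbf v}_{K\sigma}=\sum_{s\in\mathcal V_\sigma}\omega_s^\sigma\mathbf v_{\mathcal Ks}$, $\overline{\mathbf v}_K=\sum_{s\in\mathcal V_K}\omega_s^K\mathbf v_{\mathcal Ks}$. For $\sigma=K|L\in\mathcal F_\Gamma$: $[\![\mathbf v_{\mathcal D}]\!]_\sigma=\overline{\mathbf v}_{K\sigma}-\overline{\mathbf v}_{L\sigma}+\mathbf v_{K\sigma}$. For $K\in\mathcal M$: $$\nabla^K\mathbf v_{\mathcal D}=\frac1{|K|}\sum_{\sigma\in\mathcal F_K}|\sigma|\,\overline{\mathbf v}_{K\sigma}\otimes\mathbf n_{K\sigma}+\sum_{\sigma\in\mathcal F^+_{\Gamma,K}}\frac{|\sigma|}{|K|}\mathbf v_{K\sigma}\otimes\mathbf n_{K\sigma},\qquad \Pi^K\mathbf v_{\mathcal D}(\mathbf x)=\nabla^K\mathbf v_{\mathcal D}(\mathbf x-\overline{\mathbf x}_K)+\overline{\mathbf v}_K.$$ Global piecewise operators: $([\![\mathbf v_{\mathcal D}]\!]_{\mathcal D})_{|\sigma}=[\![\mathbf v_{\mathcal D}]\!]_\sigma$, $(\nabla^{\mathcal D}\mathbf v_{\mathcal D})_{|K}=\nabla^K\mathbf v_{\mathcal D}$, $(\widetilde\Pi^{\mathcal D}\mathbf v_{\mathcal D})_{|K}=\overline{\mathbf v}_K$; $\boldsymbol\varepsilon_{\mathcal D}=\frac12(\nabla^{\mathcal D}+(\nabla^{\mathcal D})^T)$, $\mathrm{div}_{\mathcal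 D}=\mathrm{Tr}(\boldsymbol\varepsilon_{\mathcal D})$, $\boldsymbol\sigma_{\mathcal D}=2\mu\boldsymbol\varepsilon_{\mathcal D}+\lambda\,\mathrm{div}_{\mathcal D}(\cdot)\mathbb I$. Stabilisation. $S_{\mu,\lambda,\mathcal D}(\mathbf u_{\mathcal D},\mathbf v_{\mathcal D})=\sum_{K\in\mathcal M}(2\mu_K+\lambda_K)S_K(\mathbf u_{\mathcal D},\mathbf v_{\mathcal D})$, with $\mu_K,\lambda_K$ the averages of $\mu,\lambda$ on $K$ and $$S_K(\mathbf u_{\mathcal D},\mathbf v_{\mathcal D})=h_K^{d-2}\sum_{s\in\mathcal V_K}(\mathbf u_{\mathcal Ks}-\Pi^K\mathbf u_{\mathcal D}(\mathbf x_s))\cdot(\mathbf v_{\mathcal Ks}-\Pi^K\mathbf v_{\mathcal D}(\mathbf x_s))+h_K^{d-2}\sum_{\sigma\in\mathcal F^+_{\Gamma,K}}\mathbf u_{K\sigma}\cdot\mathbf v_{K\sigma}.$$ Data. $\mathbf f\in L^2(\Omega)^d$; $\mu,\lambda$ are the Lamé coefficients (bounded, with $\mu$ and $2\mu+d\lambda$ bounded below by positive constants); the Tresca threshold $\mathrm g\ge0$ is constant on each $\sigma\in\mathcal F_\Gamma$. Multipliers. $\mathbf M_{\mathcal D}=\{\boldsymbol\lambda_{\mathcal D}\in L^2(\Gamma)^d: \boldsymbol\lambda_\sigma:=(\boldsymbol\lambda_{\mathcal D})_{|\sigma}\text{ is constant for all }\sigma\in\mathcal F_\Gamma\}$; $\lambda_{\mathcal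 D,\mathbf n}=\boldsymbol\lambda_{\mathcal D}\cdot\mathbf n^+$, $\boldsymbol\lambda_{\mathcal D,\boldsymbol\tau}=\boldsymbol\lambda_{\mathcal D}-\lambda_{\mathcal D,\mathbf n}\mathbf n^+$; $\mathbf C_{\mathcal D}=\{\boldsymbol\lambda_{\mathcal D}\in\mathbf M_{\mathcal D}:\lambda_{\mathcal D,\mathbf n}\ge0,\ |\boldsymbol\lambda_{\mathcal D,\boldsymbol\tau}|\le\mathrm g\}$. *)

(* Defs.v *)
From HB Require Import structures.
From mathcomp Require Import all_boot all_order all_algebra.
From mathcomp Require Import all_classical all_reals all_analysis.
From mathcomp Require Import measurable_realfun.

Set Implicit Arguments.
Unset Strict Implicit.
Unset Printing Implicit Defensive.

Import Order.TTheory GRing.Theory Num.Theory.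
Import numFieldNormedType.Exports.

Local Open Scope classical_set_scope.
Local Open Scope ring_scope.

Definition mx_display (d : measure_display) : measure_display.
Proof. exact: d. Qed.

(* Borel sets of R^(m x n): the sigma-algebra generated by the coordinates. *)
Section mx_measurable.
Context (R : realType) (m n : nat).

Definition mx_cylinders : set (set 'M[R]_(m, n)) :=
  [set B | exists i j (A : set (measurableTypeR R)),
     measurable A /\ B = (fun M : 'M[R]_(m, n) => M i j) @^-1` A].

Let mx_set0 : <<s mx_cylinders >> set0.
Proof. exact: sigma_algebra0. Qed.

Let mx_setC A : <<s mx_cylinders >> A -> <<s mx_cylinders >> (~` A).
Proof. exact: sigma_algebraC. Qed.

Let mx_bigcup (F : (set 'M[R]_(m, n))^nat) :
  (forall i, <<s mx_cylinders >> (F i)) ->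
  <<s mx_cylinders >> (\bigcup_i (F i)).
Proof. exact: sigma_algebra_bigcup. Qed.

HB.instance Definition _ := @isMeasurable.Build
  (mx_display (R.-ocitv.-measurable).-sigma) 'M[R]_(m, n) <<s mx_cylinders >>
  mx_set0 mx_setC mx_bigcup.

Lemma measurable_mx_coord i j :
  measurable_fun setT (fun M : 'M[R]_(m, n) => M i j : measurableTypeR R).
Proof.
move=> _ A mA; rewrite setTI; apply: sub_gen_smallest.
by exists i, j, A.
Qed.

Lemma measurable_fun_mxP d (T : measurableType d) (f : T -> 'M[R]_(m, n)) :
  (forall i j, measurable_fun setT (fun x => f x i j : measurableTypeR R)) ->
  measurable_fun setT f.
Proof.
move=> mf; apply: (measurability mx_cylinders) => //.
move=> _ [_ [i [j [A [mA ->]]]] <-]; exact: mf.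
Qed.

End mx_measurable.

Definition mx_cons (R : realType) n (p : measurableTypeR R * 'cV[R]_n) :
  'cV[R]_n.+1 := col_mx (p.1 : R)%:M p.2 : 'cV[R]_(1 + n).

(* n-dimensional Lebesgue measure, by iterating the product with the measure of
   the line. *)
Fixpoint lebn (R : realType) n : set 'cV[R]_n -> \bar R :=
  match n with
  | 0 => \d_(0 : 'cV[R]_0)
  | m.+1 => pushforward (lebesgue_measure \x @lebn R m)%E (@mx_cons R m)
  end.

Section lebn_measure.
Context (R : realType).

Lemma measurable_mx_cons n : measurable_fun setT (@mx_cons R n).
Proof.
apply: measurable_fun_mxP => i j; rewrite ord1.
case: (splitP (i : 'I_(1 + n))) => [k ik|k ik].
  have -> : i = lshift n k :> 'I_(1 + n) by apply/val_inj.
  rewrite (_ : (fun _ => _) = fst); first exact: measurable_fst.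
  by apply/funext => p; rewrite /mx_cons (@col_mxEu _ 1 n 1) ord1 mxE eqxx mulr1n.
have -> : i = rshift 1 k :> 'I_(1 + n) by apply/val_inj.
rewrite (_ : (fun _ => _) = (fun v : 'cV[R]_n => v k 0 : measurableTypeR R) \o snd).
  by apply: measurableT_comp; [exact: measurable_mx_coord|exact: measurable_snd].
by apply/funext => p; rewrite /mx_cons (@col_mxEd _ 1 n 1).
Qed.

Definition mx_uncons n (v : 'cV[R]_n.+1) : measurableTypeR R * 'cV[R]_n :=
  (v 0 0, dsubmx (v : 'cV[R]_(1 + n))).

Lemma measurable_mx_uncons n : measurable_fun setT (@mx_uncons n).
Proof.
apply: measurable_fun_pair; first exact: measurable_mx_coord.
apply: measurable_fun_mxP => i j.
rewrite (_ : (fun _ => _) = (fun v : 'cV[R]_n.+1 =>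
    v (rshift 1 i : 'I_n.+1) j : measurableTypeR R)); last first.
  by apply/funext => v; rewrite mxE.
exact: measurable_mx_coord.
Qed.

Lemma mx_consK n : cancel (@mx_cons R n) (@mx_uncons n).
Proof.
case=> t v; rewrite /mx_uncons /mx_cons col_mxKd; congr pair.
have -> : (0 : 'I_n.+1) = lshift n 0 :> 'I_(1 + n) by apply/val_inj.
by rewrite (@col_mxEu _ 1 n 1) mxE eqxx mulr1n.
Qed.

Lemma lebn_sigma_finite_measure n :
  exists m : {sigma_finite_measure set 'cV[R]_n -> \bar R}, @lebn R n = m.
Proof.
elim: n => [|n [m IH]]; first by exists \d_(0 : 'cV[R]_0).
pose P : {measure set (measurableTypeR R * 'cV[R]_n)%type -> \bar R} :=
  (lebesgue_measure \x m)%E.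
have sP : sigma_finite setT P.
  have /sigma_finiteP[F [TF ndF Foo]] := sigma_finiteT (@lebesgue_measure R).
  have /sigma_finiteP[G [TG ndG Goo]] := sigma_finiteT m.
  exists (fun k => F k `*` G k).
    rewrite -setXTT TF TG predeqE => -[x y]; split.
      move=> [/= [k _ Fkx] [l _ Gly]]; exists (maxn k l) => //; split.
      - by move: x Fkx; exact/subsetPset/ndF/leq_maxl.
      - by move: y Gly; exact/subsetPset/ndG/leq_maxr.
    by move=> [k _ []/= ? ?]; split; exists k.
  move=> k; have [? ?] := Foo k; have [? ?] := Goo k.
  split; first exact: measurableX.
  by rewrite /P/= product_measure1E// lte_mul_pinfty// ge0_fin_numE.
pose Q : {measure set 'cV[R]_n.+1 -> \bar R} :=
  measure_function_pushforward__canonical__measure_function_Measure P (@measurable_mx_cons n).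
have sQ : sigma_finite setT Q.
  have [F UF mF] := sP.
  exists (fun k => @mx_uncons n @^-1` F k).
    by rewrite -preimage_bigcup -UF preimage_setT.
  move=> k; have [mFk Fk] := mF k; split.
    by rewrite -[X in measurable X]setTI; exact: measurable_mx_uncons.
  rewrite /Q/= /pushforward -comp_preimage.
  by rewrite (_ : _ \o _ = id) ?preimage_id//; apply/funext => p; exact: mx_consK.
pose mx := Measure_isSigmaFinite.Build _ _ _ Q sQ.
pose QQ : {sigma_finite_measure set 'cV[R]_n.+1 -> \bar R} := HB.pack (Measure.sort Q) mx.
by exists QQ; rewrite /= IH.
Qed.

Let lebn0 n : @lebn R n set0 = 0%E.
Proof. by have [m ->] := lebn_sigma_finite_measure n; exact: measure0. Qed.

Let lebn_ge0 n A : (0 <= @lebn R n A)%E.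
Proof. by have [m ->] := lebn_sigma_finite_measure n; exact: measure_ge0. Qed.

Let lebn_sigma_additive n : semi_sigma_additive (@lebn R n).
Proof.
have [m ->] := lebn_sigma_finite_measure n.
exact: measure_semi_sigma_additive.
Qed.

HB.instance Definition _ n := isMeasure.Build _ _ _ (@lebn R n)
  (@lebn0 n) (@lebn_ge0 n) (@lebn_sigma_additive n).

Let lebn_sigma_finite n : sigma_finite setT (@lebn R n).
Proof.
have [m ->] := lebn_sigma_finite_measure n; exact: sigma_finiteT.
Qed.

HB.instance Definition _ n := Measure_isSigmaFinite.Build _ _ _ (@lebn R n)
  (@lebn_sigma_finite n).

End lebn_measure.

Section euclidean.
Context (R : realType) (d : nat).
Local Notation pt := 'cV[R]_d.
Implicit Types (x y nu : pt) (A : set pt) (c : R).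

Definition dot x y : R := \sum_i x i 0 * y i 0.

Definition enorm x : R := Num.sqrt (dot x x).

Definition diam A : R := sup [set enorm (x - y) | x in A & y in A].

Definition frontier A : set pt := closure A `\` A°.

Definition hyperplane nu c : set pt := [set x | dot nu x = c].

Definition hyperplane_proj nu c x : pt := x - (dot nu x - c) *: nu.

Lemma measurable_dot nu : measurable_fun setT (dot nu).
Proof.
apply: measurable_sum => i; apply: measurable_funM => //.
exact: measurable_mx_coord.
Qed.

Definition slab nu c : set pt := [set x | 0 <= dot nu x - c <= 1].

(* (d-1)-dimensional Lebesgue measure of the hyperplane {x | nu . x = c}, for a
   unit vector nu: the measure of A is the volume of the cylinder with base the
   part of A in the hyperplane, with generatrix nu and height 1. *)
Definition surface nu c A : \bar R :=
  lebn (slab nu c `&` hyperplane_proj nu c @^-1` A).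

Lemma measurable_slab nu c : measurable (slab nu c).
Proof.
rewrite (_ : slab nu c = (fun x => dot nu x - c) @^-1` `[0, 1]); last first.
  by apply/funext => x; rewrite /slab/= in_itv.
rewrite -[X in measurable X]setTI.
have m : measurable_fun setT (fun x => dot nu x - c).
  by apply: measurable_funB => //; exact: measurable_dot.
exact: m.
Qed.

Lemma measurable_hyperplane_proj nu c :
  measurable_fun setT (hyperplane_proj nu c).
Proof.
apply: measurable_fun_mxP => i j.
rewrite (_ : (fun _ => _) = fun x => x i j - (dot nu x - c) * nu i j); last first.
  by apply/funext => x; rewrite !mxE.
apply: measurable_funB; first exact: measurable_mx_coord.
apply: measurable_funM => //; apply: measurable_funB => //.
exact: measurable_dot.
Qed.

Let surface_pushforward nu c :
  exists m : {measure set pt -> \bar R}, surface nu c = m.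
Proof.
pose r : {measure set pt -> \bar R} := mrestr (@lebn R d) (measurable_slab nu c).
exists (measure_function_pushforward__canonical__measure_function_Measure r
  (@measurable_hyperplane_proj nu c)).
by apply/funext => A; rewrite /= /pushforward /r/= /mrestr setIC.
Qed.

Let surface0 nu c : surface nu c set0 = 0%E.
Proof. by have [m ->] := surface_pushforward nu c; exact: measure0. Qed.

Let surface_ge0 nu c A : (0 <= surface nu c A)%E.
Proof. by have [m ->] := surface_pushforward nu c; exact: measure_ge0. Qed.

Let surface_sigma_additive nu c : semi_sigma_additive (surface nu c).
Proof.
have [m ->] := surface_pushforward nu c; exact: measure_semi_sigma_additive.
Qed.

HB.instance Definition _ nu c := isMeasure.Build _ _ _ (surface nu c)
  (@surface0 nu c) (@surface_ge0 nu c) (@surface_sigma_additive nu c).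

End euclidean.

Section polytopes.
Context (R : realType) (d : nat).
Local Notation pt := 'cV[R]_d.

Definition affinely_independent k (p : 'I_k -> pt) : Prop :=
  forall w : 'I_k -> R, \sum_i w i = 0 -> \sum_i w i *: p i = 0 ->
    forall i, w i = 0.

Definition conv_hull k (p : 'I_k -> pt) (S : {set 'I_k}) : set pt :=
  [set x | exists w : 'I_k -> R,
    [/\ forall i, 0 <= w i, forall i, i \notin S -> w i = 0,
        \sum_i w i = 1 & x = \sum_i w i *: p i]].

Definition open_conv_hull k (p : 'I_k -> pt) (S : {set 'I_k}) : set pt :=
  [set x | exists w : 'I_k -> R,
    [/\ forall i, i \in S -> 0 < w i, forall i, i \notin S -> w i = 0,
        \sum_i w i = 1 & x = \sum_i w i *: p i]].

(* Polytopal domains of a k-dimensional affine subspace H: nonempty, connected,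
   relatively open, equal to the relative interior of their closure, which is a
   finite union of k-simplices (in particular, bounded). *)
Definition polytopal_domain k (H A : set pt) : Prop :=
  [/\ A !=set0, connected A,
      A = [set x | H x /\ \forall y \near x, H y -> closure A y] &
      exists (N : nat) (p : 'I_N -> 'I_k.+1 -> pt),
        (forall j, affinely_independent (p j)) /\
        closure A = \bigcup_j conv_hull (p j) [set: 'I_k.+1]%SET].

Definition simply_connected (A : set pt) : Prop :=
  forall gamma : R -> pt,
    {within `[0, 1]%classic, continuous gamma} ->
    (forall t, 0 <= t <= 1 -> A (gamma t)) -> gamma 0 = gamma 1 ->
    exists h : R * R -> pt,
      [/\ {within `[0, 1]%classic `*` `[0, 1]%classic, continuous h},
          forall t s, 0 <= t <= 1 -> 0 <= s <= 1 -> A (h (t, s)),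
          forall t, 0 <= t <= 1 -> h (t, 0) = gamma t /\ h (t, 1) = gamma 0 &
          forall s, 0 <= s <= 1 -> h (0, s) = gamma 0 /\ h (1, s) = gamma 0].

Definition open_segment (x y : pt) : set pt :=
  [set z | exists2 t : R, 0 < t < 1 & z = (1 - t) *: x + t *: y].

End polytopes.

Section geometry.
Context (R : realType) (d : nat).
Local Notation pt := 'cV[R]_d.

(* fracture_normal i is n^+ on the fracture i, and n^- = - n^+. *)
Record fracture_network := FractureNetwork {
  fracture_index : finType;
  fracture : fracture_index -> set pt;
  fracture_normal : fracture_index -> pt;
  fracture_offset : fracture_index -> R }.

Definition network_closure (G : fracture_network) : set pt :=
  \bigcup_i closure (@fracture G i).

Record is_fracture_network (Omega : set pt) (G : fracture_network) : Prop := {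
  fracture_normal_unit : forall i : fracture_index G,
    enorm (fracture_normal i) = 1;
  fracture_polygonal : forall i : fracture_index G,
    polytopal_domain d.-1 (hyperplane (fracture_normal i) (fracture_offset i))
      (fracture i);
  fracture_simply_connected : forall i : fracture_index G,
    simply_connected (fracture i);
  fracture_sub : forall i : fracture_index G, fracture i `<=` Omega;
  (* distinct fractures may only intersect at their boundaries *)
  fracture_disjoint : forall i j : fracture_index G, i != j ->
    fracture i `&` closure (fracture j) = set0;
  complement_connected : connected (Omega `\` network_closure G) }.

(* The face s lies in the hyperplane face_normal s . x = face_offset s, with an
   arbitrary orientation. plus_cell s and minus_cell s are the labels K and L of
   a fracture face s = K|L; they are irrelevant on the other faces. *)
Record mesh := Mesh {
  cell : finType;
  face : finType;
  edge : finType;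
  node : finType;
  cell_set : cell -> set pt;
  face_set : face -> set pt;
  face_normal : face -> pt;
  face_offset : face -> R;
  edge_tail : edge -> node;
  edge_head : edge -> node;
  pos : node -> pt;
  fracture_faces : {set face};
  plus_cell : face -> cell;
  minus_cell : face -> cell }.

Section mesh_sets.
Context (Omega : set pt) (G : fracture_network) (M : mesh).

Definition edge_set (e : edge M) : set pt :=
  open_segment (pos (edge_tail e)) (pos (edge_head e)).

Definition cell_faces (K : cell M) : {set face M} :=
  [set s | `[< face_set s `<=` frontier (cell_set K) >]]%SET.

Definition cell_nodes (K : cell M) : {set node M} :=
  [set a | `[< closure (cell_set K) (pos a) >]]%SET.

Definition face_nodes (s : face M) : {set node M} :=
  [set a | `[< closure (face_set s) (pos a) >]]%SET.

Definition face_cells (s : face M) : {set cell M} :=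
  [set K | s \in cell_faces K]%SET.

Definition face_boundary (s : face M) : set pt :=
  closure (face_set s) `\` face_set s.

Definition is_outward (K : cell M) (s : face M) (nu : pt) : Prop :=
  forall x, face_set s x -> \forall t \near (0 : R)^'+,
    cell_set K (x - t *: nu) /\ ~ closure (cell_set K) (x + t *: nu).

Definition outward_normal (K : cell M) (s : face M) : pt :=
  if `[< is_outward K s (face_normal s) >] then face_normal s
  else - face_normal s.

(* n^+ on a face contained in a fracture *)
Definition nplus (s : face M) : pt :=
  if [pick i | `[< face_set s `<=` @fracture G i >]] is Some i
  then fracture_normal i else 0.

Definition plus_fracture_faces (K : cell M) : {set face M} :=
  [set s in fracture_faces M |
    (s \in cell_faces K) && (0 < dot (outward_normal K s) (nplus s))]%SET.

Record is_conforming_mesh : Prop := {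
  cell_polyhedral : forall K : cell M, polytopal_domain d setT (cell_set K);
  cell_sub : forall K : cell M, cell_set K `<=` Omega;
  cell_disjoint : forall K L : cell M, K != L ->
    cell_set K `&` cell_set L = set0;
  cell_cover : closure Omega = \bigcup_K closure (@cell_set M K);
  face_normal_unit : forall s : face M, enorm (face_normal s) = 1;
  face_planar : forall s : face M,
    polytopal_domain d.-1 (hyperplane (face_normal s) (face_offset s))
      (face_set s);
  face_disjoint : forall s t : face M, s != t ->
    face_set s `&` face_set t = set0;
  cell_frontier : forall K : cell M,
    frontier (cell_set K) =
      \bigcup_(s in [set` cell_faces K]) closure (face_set s);
  face_adjacency : forall s : face M,
    (#|face_cells s| = 1%N /\ face_set s `<=` frontier Omega) \/
    (#|face_cells s| = 2%N /\ face_set s `<=` Omega);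
  pos_inj : injective (@pos M);
  edge_ends : forall e : edge M, edge_tail e != edge_head e;
  edge_disjoint : forall e e' : edge M, e != e' ->
    edge_set e `&` edge_set e' = set0;
  edge_no_node : forall (e : edge M) (a : node M), ~ edge_set e (pos a);
  node_edge : forall a : node M,
    exists e : edge M, (a == edge_tail e) || (a == edge_head e);
  (* in dimension 2, the edges are the faces *)
  face_edges2 : d = 2%N ->
    (forall s : face M, exists e : edge M, face_set s = edge_set e) /\
    (forall e : edge M, exists s : face M, edge_set e = face_set s);
  face_edges3 : d = 3%N ->
    (forall s : face M, face_boundary s =
       \bigcup_(e in [set e : edge M | edge_set e `<=` face_boundary s])
         closure (edge_set e)) /\
    (forall e : edge M, exists s : face M, edge_set e `<=` face_boundary s);
  fracture_mesh : network_closure G =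
    \bigcup_(s in [set` fracture_faces M]) closure (face_set s);
  fracture_face : forall s : face M, s \in fracture_faces M ->
    exists i, face_set s `<=` @fracture G i;
  fracture_face_sides : forall s : face M, s \in fracture_faces M ->
    [/\ face_cells s = [set plus_cell s; minus_cell s]%SET,
        plus_cell s != minus_cell s,
        outward_normal (plus_cell s) s = nplus s &
        outward_normal (minus_cell s) s = - nplus s] }.

End mesh_sets.

Definition inradius (A : set pt) : R :=
  sup [set r | 0 <= r /\ exists c, [set x | enorm (x - c) <= r] `<=` A].

(* p tau i is the i-th vertex of the simplex tau. *)
Record is_simplicial_submesh (Omega : set pt) (M : mesh)
    (N : nat) (p : 'I_N -> 'I_d.+1 -> pt) : Prop := {
  simplex_nondegenerate : forall tau, affinely_independent (p tau);
  simplex_disjoint : forall tau tau', tau != tau' ->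
    open_conv_hull (p tau) [set: 'I_d.+1]%SET `&`
    open_conv_hull (p tau') [set: 'I_d.+1]%SET = set0;
  simplex_cover :
    closure Omega = \bigcup_tau conv_hull (p tau) [set: 'I_d.+1]%SET;
  (* two simplices meet along the simplex of their common vertices *)
  simplex_matching : forall tau tau',
    conv_hull (p tau) [set: 'I_d.+1]%SET `&`
    conv_hull (p tau') [set: 'I_d.+1]%SET =
    conv_hull (p tau) [set i | [exists j, p tau i == p tau' j]]%SET;
  simplex_cell : forall tau, exists! K : cell M,
    open_conv_hull (p tau) [set: 'I_d.+1]%SET `<=` cell_set K;
  simplex_face : forall tau (i : 'I_d.+1) (s : face M),
    open_conv_hull (p tau) [set~ i]%SET `<=` face_set s \/
    open_conv_hull (p tau) [set~ i]%SET `&` face_set s = set0 }.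

Definition is_regular_mesh (Omega : set pt) (M : mesh) : Prop :=
  exists (N : nat) (p : 'I_N -> 'I_d.+1 -> pt) (rho : R),
    [/\ is_simplicial_submesh Omega M p, 0 < rho < 1,
        forall tau, rho * diam (conv_hull (p tau) [set: 'I_d.+1]%SET)
                    <= inradius (conv_hull (p tau) [set: 'I_d.+1]%SET) &
        forall tau (K : cell M),
          open_conv_hull (p tau) [set: 'I_d.+1]%SET `<=` cell_set K ->
          rho * diam (cell_set K)
          <= diam (conv_hull (p tau) [set: 'I_d.+1]%SET)].

End geometry.

Section scheme.
Context (R : realType) (d : nat).
Local Notation pt := 'cV[R]_d.
Context (Omega : set pt) (G : fracture_network R d) (M : mesh R d).
Implicit Types (K L : cell M) (s : face M) (a : node M).

(* Some local connected component of the complement of the network near the node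
   a meets both K and L. Letting r be arbitrary amounts to letting it be small,
   since the components shrink with r. *)
Definition same_side a K L : Prop := forall r : R, 0 < r ->
  exists x y, [/\ cell_set K x, cell_set L y &
    connected_component ((Omega `\` network_closure G) `&` ball (pos a) r) x y].

(* v.1 (K, a) is v_{Ka}, the value of v at the node a on the side of the cell K;
   v.2 (K, s) is v_{Ks}, the bubble unknown at the face s of K. The families are
   extended by 0 outside of their index sets. *)
Definition dofs : Type :=
  ({ffun cell M * node M -> pt} * {ffun cell M * face M -> pt})%type.

Implicit Types u v : dofs.

Definition in_U0 v : Prop :=
  [/\ forall K a, a \notin cell_nodes K -> v.1 (K, a) = 0,
      forall K s, s \notin plus_fracture_faces G K -> v.2 (K, s) = 0,
      forall K a, a \in cell_nodes K -> frontier Omega (pos a) ->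
        v.1 (K, a) = 0 &
      forall K L a, a \in cell_nodes K -> a \in cell_nodes L ->
        same_side a K L -> v.1 (K, a) = v.1 (L, a)].

Definition volume K : R := fine (lebn (cell_set K)).

Definition face_measure s : measure pt R := surface (face_normal s) (face_offset s).

Definition area s : R := fine (face_measure s (face_set s)).

Definition cell_center K : pt :=
  \col_i ((volume K)^-1 * \int[@lebn R d]_(x in cell_set K) x i 0).

Definition face_center s : pt :=
  \col_i ((area s)^-1 * \int[face_measure s]_(x in face_set s) x i 0).

Record are_weights (wF : face M -> node M -> R) (wC : cell M -> node M -> R) :
    Prop := {
  face_weight_ge0 : forall s a, a \in face_nodes s -> 0 <= wF s a;
  face_weight_sum : forall s, \sum_(a in face_nodes s) wF s a = 1;
  face_weight_center : forall s,
    \sum_(a in face_nodes s) wF s a *: pos a = face_center s;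
  cell_weight_ge0 : forall K a, a \in cell_nodes K -> 0 <= wC K a;
  cell_weight_sum : forall K, \sum_(a in cell_nodes K) wC K a = 1;
  cell_weight_center : forall K,
    \sum_(a in cell_nodes K) wC K a *: pos a = cell_center K }.

Context (wF : face M -> node M -> R) (wC : cell M -> node M -> R).

Definition face_mean v K s : pt :=
  \sum_(a in face_nodes s) wF s a *: v.1 (K, a).

Definition cell_mean v K : pt :=
  \sum_(a in cell_nodes K) wC K a *: v.1 (K, a).

Definition face_jump v s : pt :=
  face_mean v (plus_cell s) s - face_mean v (minus_cell s) s
  + v.2 (plus_cell s, s).

Definition cell_grad v K : 'M[R]_d :=
  (volume K)^-1 *: (\sum_(s in cell_faces K)
    area s *: (face_mean v K s *m (outward_normal K s)^T))
  + \sum_(s in plus_fracture_faces G K)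
    (area s / volume K) *: (v.2 (K, s) *m (outward_normal K s)^T).

Definition cell_recons v K (x : pt) : pt :=
  cell_grad v K *m (x - cell_center K) + cell_mean v K.

(* The function equal to q i on E i, for pairwise disjoint sets E i, and to 0
   elsewhere. *)
Definition piecewise (I : finType) (V : zmodType) (E : I -> set pt) (q : I -> V)
    (x : pt) : V :=
  if [pick i | `[< E i x >]] is Some i then q i else 0.

Definition jumpD v : pt -> pt := piecewise (@face_set _ _ M) (face_jump v).

Definition gradD v : pt -> 'M[R]_d := piecewise (@cell_set _ _ M) (cell_grad v).

Definition reconsD v : pt -> pt := piecewise (@cell_set _ _ M) (cell_mean v).

Definition strainD v x : 'M[R]_d := 2^-1 *: (gradD v x + (gradD v x)^T).

Definition divD v x : R := \tr (strainD v x).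

Definition frobenius (A B : 'M[R]_d) : R := \sum_i \sum_j A i j * B i j.

Section data.
Context (f : pt -> pt) (mu lambda : pt -> R) (g : face M -> R).

Definition is_L2_field : Prop := forall i : 'I_d,
  measurable_fun Omega (fun x => f x i 0) /\
  (@lebn R d).-integrable Omega (fun x => ((f x i 0) ^+ 2)%:E).

Record are_lame_coefficients : Prop := {
  mu_measurable : measurable_fun Omega mu;
  lambda_measurable : measurable_fun Omega lambda;
  lame_bounded : exists B : R, forall x, Omega x ->
    `|mu x| <= B /\ `|lambda x| <= B;
  lame_coercive : exists c : R, 0 < c /\
    forall x, Omega x -> c <= mu x /\ c <= 2 * mu x + d%:R * lambda x }.

Definition stressD v x : 'M[R]_d :=
  (2 * mu x) *: strainD v x + (lambda x * divD v x)%:M.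

Definition cell_average (phi : pt -> R) K : R :=
  (volume K)^-1 * \int[@lebn R d]_(x in cell_set K) phi x.

Definition cell_stab u v K : R :=
  diam (cell_set K) ^+ (d - 2) * (\sum_(a in cell_nodes K)
    dot (u.1 (K, a) - cell_recons u K (pos a))
        (v.1 (K, a) - cell_recons v K (pos a)))
  + diam (cell_set K) ^+ (d - 2) *
    (\sum_(s in plus_fracture_faces G K) dot (u.2 (K, s)) (v.2 (K, s))).

Definition stabD u v : R :=
  \sum_K (2 * cell_average mu K + cell_average lambda K) * cell_stab u v K.

(* A multiplier is given by its values on the fracture faces, extended by 0 to
   the other faces; multD q is the corresponding function on the network. *)
Definition multipliers : Type := {ffun face M -> pt}.

Implicit Types q : multipliers.

Definition in_MD q : Prop := forall s, s \notin fracture_faces M -> q s = 0.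

Definition multD q : pt -> pt := piecewise (@face_set _ _ M) q.

Definition normal_part q s : R := dot (q s) (nplus G s).

Definition tangential_part q s : pt := q s - normal_part q s *: nplus G s.

Definition in_CD q : Prop := in_MD q /\
  forall s, s \in fracture_faces M ->
    0 <= normal_part q s /\ enorm (tangential_part q s) <= g s.

Definition network_integral (phi : pt -> R) : R :=
  \sum_i \int[surface (fracture_normal i) (fracture_offset i)]_(x in
    @fracture _ _ G i) phi x.

Definition is_solution u q : Prop :=
  forall v q', in_U0 v -> in_CD q' ->
    \int[@lebn R d]_(x in Omega) frobenius (stressD u x) (strainD v x)
      + stabD u v
      + network_integral (fun x => dot (multD q x) (jumpD v x))
    = \int[@lebn R d]_(x in Omega) dot (f x) (reconsD v x)
    /\ network_integral (fun x => dot (multD q' x - multD q x) (jumpD u x)) <= 0.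

End data.
End scheme.

(* Main.v *)
Require Import Defs.
From mathcomp Require Import all_boot all_order all_algebra.
From mathcomp Require Import all_classical all_reals all_analysis.
From mathcomp Require Import ring lra measurable_realfun.
Set Implicit Arguments.
Unset Strict Implicit.
Unset Printing Implicit Defensive.

Import Order.TTheory GRing.Theory Num.Theory.
Import numFieldNormedType.Exports.

Local Open Scope classical_set_scope.
Local Open Scope ring_scope.

(** The problem is a finite-dimensional saddle point problem. Once the integrals
    over the domain and the network are written as sums over the cells and the
    faces, it reads
    a(u, v) + b(q, v) = l(v) for all v in U_0, and b(q' - q, u) <= 0 for all q'
    in the closed convex set C, where the bilinear form a is symmetric and b is
    a weighted sum of products of multipliers and jumps over the faces.

    If a is positive definite on U_0 and no nonzero multiplier is orthogonal to
    all jumps, eliminating u leaves a variational inequality for q on C, with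
    the symmetric positive definite matrix B A^-1 B^T. Its solution is the
    minimiser of a quadratic function on C, which exists since this function is
    coercive, even though C is unbounded [saddle_point]. For two solutions, the
    difference of the equations tested with the difference of the displacements
    and the two inequalities give a(u - u', u - u') <= 0, so u = u', and then
    q = q'.

    The second condition holds thanks to the bubbles: their jump is any vector
    on one face of the network and zero on the others [coupling_inj]. It
    requires the weights of b to be positive, that is, a face in a fracture to
    have positive surface measure [face_weight_gt0].

    The first one is a discrete Korn inequality without constant
    [energy_definite]. If a(v, v) = 0, the lower bounds on the Lame coefficients
    give zero strains and zero stabilisation: v has no bubble, and in each cell
    it coincides at the nodes with a rigid motion. A rigid motion vanishing at
    the nodes of one face is zero [rigid_motion_face_eq0]. This applies to a
    cell with a face on the boundary of the domain, and passes from a cell to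
    its neighbour through a face off the network, because at the nodes of such a
    face both cells are on the same side of the network [same_side_face]. All
    cells are reached in this way because the complement of the network is
    connected [cells_connected]. The topological facts used here come from one
    remark: a generic segment between two open sets does not meet the
    boundaries of the faces, which have codimension 2 [generic_segment]; so it
    goes from one cell to another, or out of the domain, through the inside of a
    face. *)

(** * Minimisation of quadratic functions on closed convex sets *)

Lemma continuous_sum (R : realType) (T : topologicalType) (I : Type)
    (r : seq I) (F : I -> T -> R) :
  (forall i, continuous (F i)) -> continuous (fun x => \sum_(i <- r) F i x).
Proof.
move=> cF; elim: r => [|i r IH].
  under eq_fun do rewrite big_nil.
  by move=> x; exact: cst_continuous.
under eq_fun do rewrite big_cons.
move=> x; apply: (@continuousD _ _ _ (F i)); [exact: cF|exact: IH].
Qed.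

Section mx_inequalities.
Context (R : realType).

Lemma le_mx_norm m n (x : 'M[R]_(m, n)) i j : `|x i j| <= `|x|.
Proof.
rewrite [leRHS]/Num.norm /= mx_normrE; apply/bigmax_geP; right.
by exists (i, j).
Qed.

Definition bform m n (A : 'M[R]_(m, n)) (x : 'rV_m) (y : 'rV_n) : R :=
  (x *m A *m y^T) 0 0.

Lemma bformE m n (A : 'M[R]_(m, n)) x y :
  bform A x y = \sum_j (\sum_i x 0 i * A i j) * y 0 j.
Proof. by rewrite /bform mxE; apply: eq_bigr => j _; rewrite !mxE. Qed.

Lemma bformDl m n (A : 'M[R]_(m, n)) x x' y :
  bform A (x + x') y = bform A x y + bform A x' y.
Proof. by rewrite /bform !mulmxDl mxE. Qed.

Lemma bformDr m n (A : 'M[R]_(m, n)) x y y' :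
  bform A x (y + y') = bform A x y + bform A x y'.
Proof. by rewrite /bform linearD mulmxDr mxE. Qed.

Lemma bformZl m n (A : 'M[R]_(m, n)) k x y :
  bform A (k *: x) y = k * bform A x y.
Proof. by rewrite /bform -!scalemxAl mxE. Qed.

Lemma bformZr m n (A : 'M[R]_(m, n)) k x y :
  bform A x (k *: y) = k * bform A x y.
Proof. by rewrite /bform linearZ -scalemxAr mxE. Qed.

Lemma bform_tr m n (A : 'M[R]_(m, n)) x y : bform A x y = bform A^T y x.
Proof.
rewrite /bform -[in LHS](trmxK (x *m A *m y^T)) mxE.
by rewrite trmx_mul trmxK trmx_mul mulmxA.
Qed.

Lemma continuous_bform_diag n (A : 'M[R]_n) : continuous (fun x => bform A x x).
Proof.
under eq_fun do rewrite bformE.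
apply: continuous_sum => j x; apply: (@continuousM R 'rV[R]_n (fun x : 'rV[R]_n => \sum_i x 0 i * A i j)).
  apply: continuous_sum => i {}x; apply: (@continuousM R 'rV[R]_n (fun x : 'rV[R]_n => x 0 i)).
    exact: coord_continuous.
  exact: cst_continuous.
exact: coord_continuous.
Qed.

Lemma continuous_linform n (b : 'cV[R]_n) :
  continuous (fun x : 'rV[R]_n => (x *m b) 0 0).
Proof.
under eq_fun do rewrite mxE.
apply: continuous_sum => i x; apply: (@continuousM R 'rV[R]_n (fun x : 'rV[R]_n => x 0 i)).
  exact: coord_continuous.
exact: cst_continuous.
Qed.

(** The constant is the minimum of the form on the unit sphere. *)
Lemma posdef_lower_bound n (A : 'M[R]_n) :
  (forall x, x != 0 -> 0 < bform A x x) ->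
  exists2 m, 0 < m & forall x, m * `|x| ^+ 2 <= bform A x x.
Proof.
move=> A0; pose S := [set x : 'rV[R]_n | `|x| = 1].
have A00 : bform A 0 0 = 0 by rewrite /bform mul0mx mul0mx mxE.
have nS x : x != 0 -> S (`|x|^-1 *: x).
  move=> x0; rewrite /S/= normrZ normfV normr_id mulVf//.
  by rewrite normr_eq0.
have [S0|/set0P/negP/negPn/eqP S0] := pselect (S !=set0); last first.
  exists 1 => // x; have [->|/nS] := eqVneq x 0; last by rewrite S0.
  by rewrite normr0 A00 expr0n mulr0.
have cS : compact S.
  apply: bounded_closed_compact.
    exists 1; split; first exact: num_real.
    by move=> r r1 x /= ->; exact: ltW.
  rewrite (_ : S = (Num.norm : _ -> R) @^-1` [set 1])//.
  apply: preimage_closed; first by move=> x _; exact: norm_continuous.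
  exact: closed_eq.
have [z] := @EVT_min_rV _ _ (fun x => bform A x x) _ S0 cS
  (continuous_subspaceT (@continuous_bform_diag _ A)).
rewrite inE => Sz zmin; exists (bform A z z).
  by apply: A0; rewrite -normr_eq0 (_ : `|z| = 1)// oner_eq0.
move=> x; have [->|x0] := eqVneq x 0; first by rewrite normr0 A00 expr0n mulr0.
have := zmin _ (mem_set (nS _ x0)); rewrite bformZl bformZr mulrA.
have x1 : 0 < `|x| by rewrite normr_gt0.
by rewrite -invfM -expr2 mulrC ler_pdivlMr// exprn_gt0.
Qed.

(** The inequality is the first order optimality condition, along the segment
    towards y, for the minimiser of x A x^T / 2 - x b on C. A minimum exists
    because the quadratic part dominates at infinity. *)
Lemma variational_inequality n (A : 'M[R]_n) (b : 'cV[R]_n) (C : set 'rV[R]_n) :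
  A^T = A -> (forall x, x != 0 -> 0 < bform A x x) ->
  closed C -> C !=set0 ->
  (forall x y t, 0 <= t <= 1 -> C x -> C y -> C (x + t *: (y - x))) ->
  exists2 x, C x & forall y, C y -> ((y - x) *m b) 0 0 <= bform A x (y - x).
Proof.
move=> symA posA cC [x0 Cx0] convC.
pose l (x : 'rV[R]_n) := (x *m b) 0 0.
pose J x := 2^-1 * bform A x x - l x.
have cJ : continuous J.
  move=> x; apply: (@continuousB _ _ _ (fun x : 'rV[R]_n => 2^-1 * bform A x x)).
    apply: (@continuousM _ _ (cst 2^-1)); first exact: cst_continuous.
    exact: continuous_bform_diag.
  exact: continuous_linform.
have [m m0 mA] := posdef_lower_bound posA.
pose L := \sum_i `|b i 0|.
have L0 : 0 <= L by apply: sumr_ge0 => i _; exact: normr_ge0.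
have lL x : l x <= L * `|x|.
  rewrite /l mxE mulr_suml; apply: ler_sum => i _.
  rewrite (le_trans (ler_norm _))// normrM mulrC ler_wpM2l//.
  exact: le_mx_norm.
(* Outside of the ball of radius r, J exceeds its value at x0. *)
pose r := `|x0| + 2 * (L + `|J x0|) / m + 1.
have r1 : 1 <= r.
  rewrite /r lerDr addr_ge0// divr_ge0 ?(ltW m0)//.
  by rewrite mulr_ge0// addr_ge0.
pose K := C `&` [set x | `|x| <= r].
have Kx0 : K x0.
  split => //=; rewrite /r -addrA lerDl addr_ge0// divr_ge0 ?(ltW m0)//.
  by rewrite mulr_ge0// addr_ge0.
have cK : compact K.
  apply: bounded_closed_compact.
    exists r; split; first exact: num_real.
    by move=> s rs x [_ /= /le_trans]; apply; exact: ltW.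
  apply: closedI => //.
  rewrite (_ : [set x | _] = (Num.norm : _ -> R) @^-1` [set y | y <= r])//.
  apply: preimage_closed; first by move=> x _; exact: norm_continuous.
  exact: closed_le.
have [x] := @EVT_min_rV _ _ J _ (ex_intro _ _ Kx0) cK (continuous_subspaceT cJ).
rewrite inE => -[Cx xr] xmin.
have {}xmin y : C y -> J x <= J y.
  move=> Cy; have [yr|ry] := leP `|y| r.
    by apply: xmin; rewrite inE.
  apply: (le_trans (xmin x0 _)); first by rewrite inE.
  have y1 : 1 <= `|y| by apply: (le_trans r1); exact: ltW.
  have : 2 * (L + `|J x0|) <= m * `|y|.
    rewrite -ler_pdivrMl// mulrC (le_trans _ (ltW ry))//.
    by rewrite /r -addrA addrCA lerDl addr_ge0.
  have := mA y; have := lL y; have := ler_norm (J x0).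
  have : 0 <= `|J x0| by [].
  by rewrite /J; move: (bform A y y) (l y) (`|_ - _|) => q ly j; nra.
exists x => // y Cy; rewrite leNgt; apply/negP => lt.
pose D := bform A x (y - x) - l (y - x).
pose Q := bform A (y - x) (y - x).
have D0 : D < 0 by rewrite /D subr_lt0.
have Q0 : 0 <= Q.
  rewrite /Q; have [->|/posA/ltW//] := eqVneq (y - x) 0.
  by rewrite /bform mul0mx mul0mx mxE.
(* For this t the first order term t D outweighs the second order one. *)
pose t := Num.min 1 (- D / (Q + 1)).
have t0 : 0 < t by rewrite lt_min ltr01/= divr_gt0 ?oppr_gt0// ltr_wpDl.
have t1 : t <= 1 by rewrite ge_min lexx.
have tD : t * (Q + 1) <= - D by rewrite -ler_pdivlMr ?ltr_wpDl// ge_min lexx orbT.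
have : J x <= J (x + t *: (y - x)).
  by apply: xmin; apply: convC => //; rewrite t1 ltW.
rewrite /J !bformDl !bformDr !bformZl !bformZr.
rewrite (bform_tr _ (y - x) x) symA.
rewrite (_ : l (x + t *: (y - x)) = l x + t * l (y - x)); last first.
  by rewrite /l mulmxDl -scalemxAl !mxE.
rewrite -/Q; move: D0 tD; rewrite /D.
move: (bform A x x) (bform A x (y - x)) (l x) (l (y - x)) => a c lx ly.
by move=> D0 tD; nra.
Qed.

End mx_inequalities.

(** * Finite-dimensional saddle points *)

Section saddle.
Context (R : realType).

(** The basis is a free family of maximal size among those contained in P. *)
Lemma subspace_basis (V : vectType R) (P : V -> Prop) :
  P 0 -> (forall k u v, P u -> P v -> P (k *: u + v)) ->
  exists n (e : 'I_n -> V),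
    [/\ forall x : 'rV_n, P (\sum_i x 0 i *: e i),
        forall v, P v -> exists x : 'rV_n, v = \sum_i x 0 i *: e i &
        forall x : 'rV_n, \sum_i x 0 i *: e i = 0 -> x = 0].
Proof.
move=> P0 PL.
pose Q n := `[< exists X : n.-tuple V, free X /\ forall v, v \in X -> P v >].
have Q0 : exists n, Q n.
  by exists 0; apply/asboolP; exists [tuple]; split; rewrite ?nil_free.
have Qub n : Q n -> (n <= \dim {:V})%N.
  move=> /asboolP[X [/eqP fX _]]; rewrite -(size_tuple X) -fX.
  by rewrite dimvS// subvf.
case: (ex_maxnP Q0 Qub) => n /asboolP[X [fX PX]] nmax.
exists n, (fun i => X`_i); split.
- move=> x; elim/big_rec: _ => // i v _ Pv; apply: PL => //.
  by apply: PX; rewrite mem_nth// size_tuple.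
- move=> v Pv; exists (\row_i coord X i v).
  have vX : v \in <<X>>%VS.
    apply: contrapT => /negP vX.
    suff /nmax : Q n.+1 by rewrite ltnn.
    apply/asboolP; exists [tuple of v :: X]; split.
      by rewrite free_cons vX.
    by move=> w; rewrite inE => /predU1P[->//|/PX].
  rewrite {1}(coord_span vX); apply: eq_bigr => i _; by rewrite mxE.
- move=> x x0; apply/rowP => i; rewrite mxE.
  by move/freeP: fX => /(_ (fun i => x 0 i) x0 i).
Qed.

(** Eliminating u = (b - q B) A^-1 leaves a variational inequality for q with
    the matrix B A^-1 B^T, which is positive definite because q B = 0 forces
    q = 0. *)
Lemma saddle_point_mx m n (A : 'M[R]_n) (B : 'M[R]_(m, n)) (b : 'rV[R]_n)
    (C : set 'rV[R]_m) :
  A^T = A -> (forall x, x != 0 -> 0 < bform A x x) ->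
  (forall q : 'rV_m, q *m B = 0 -> q = 0) ->
  closed C -> C !=set0 ->
  (forall x y t, 0 <= t <= 1 -> C x -> C y -> C (x + t *: (y - x))) ->
  exists u q, [/\ C q, u *m A + q *m B = b &
    forall q', C q' -> bform B (q' - q) u <= 0].
Proof.
move=> symA posA injB cC C0 convC.
have uA : A \in unitmx.
  rewrite -row_free_unit; apply/row_freeP.
  have : kermx A = 0.
    apply/row_matrixP => i; rewrite row0.
    have [//|/posA] := eqVneq (row i (kermx A)) 0.
    have /sub_kermxP kA : (row i (kermx A) <= kermx A)%MS by exact: row_sub.
    by rewrite /bform kA mul0mx mxE ltxx.
  by move/eqP; rewrite kermx_eq0 => /row_freeP.
have symAV : (invmx A)^T = invmx A by rewrite trmx_inv symA.
pose D := B *m invmx A *m B^T.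
have symD : D^T = D by rewrite /D !trmx_mul trmxK symAV mulmxA.
have posD q : q != 0 -> 0 < bform D q q.
  move=> q0; have : q *m B *m invmx A != 0.
    apply: contra_neq q0 => /(congr1 (fun x => x *m A)).
    by rewrite mulmxKV// mul0mx; exact: injB.
  move/posA; congr (0 < _).
  by rewrite /bform mulmxKV// !trmx_mul symAV /D !mulmxA.
have [q Cq hq] := variational_inequality (B *m invmx A *m b^T) symD posD cC C0 convC.
exists ((b - q *m B) *m invmx A), q; split=> //; first by rewrite mulmxKV// subrK.
move=> q' /hq; rewrite bform_tr symD.
rewrite /bform !trmx_mul symAV linearB/= trmx_mul => h.
rewrite mulmxBr mulmxBr [leLHS]mxE [X in _ + X]mxE subr_le0.
by move: h; rewrite /D !mulmxA.
Qed.

Lemma scalar_sum (V : lmodType R) (f : V -> R) :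
  (forall k u v, f (k *: u + v) = k * f u + f v) ->
  forall n (x : 'rV[R]_n) (e : 'I_n -> V),
    f (\sum_i x 0 i *: e i) = \sum_i x 0 i * f (e i).
Proof.
move=> fL n x e; have f0 : f 0 = 0.
  by have := fL 1 0 0; rewrite scaler0 addr0 mul1r; lra.
apply: (big_ind2 (fun u v => f u = v)) => //.
- by move=> u a v b <- <-; have := fL 1 u v; rewrite scale1r mul1r.
- by move=> i _; have := fL (x 0 i) (e i) 0; rewrite addr0 f0 addr0.
Qed.

(** The coordinate-free form of [saddle_point_mx]. The closedness of C is asked
    in all systems of coordinates, since an abstract vector space carries no
    topology. *)
Lemma saddle_point (V N : vectType R) (P : V -> Prop) (Q C : N -> Prop)
    (a : V -> V -> R) (b : N -> V -> R) (l : V -> R) :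
  P 0 -> (forall k u v, P u -> P v -> P (k *: u + v)) ->
  Q 0 -> (forall k u v, Q u -> Q v -> Q (k *: u + v)) ->
  (forall u v, a u v = a v u) ->
  (forall w k u v, a (k *: u + v) w = k * a u w + a v w) ->
  (forall w k u v, b (k *: u + v) w = k * b u w + b v w) ->
  (forall q k u v, b q (k *: u + v) = k * b q u + b q v) ->
  (forall k u v, l (k *: u + v) = k * l u + l v) ->
  (forall v, P v -> 0 <= a v v) -> (forall v, P v -> a v v = 0 -> v = 0) ->
  (forall q, Q q -> (forall v, P v -> b q v = 0) -> q = 0) ->
  (forall q, C q -> Q q) -> C 0 ->
  (forall p q t, 0 <= t <= 1 -> C p -> C q -> C (p + t *: (q - p))) ->
  (forall n (e : 'I_n -> N), closed [set x : 'rV[R]_n | C (\sum_i x 0 i *: e i)]) ->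
  exists u q, [/\ P u, C q, forall v, P v -> a u v + b q v = l v &
    forall q', C q' -> b (q' - q) u <= 0].
Proof.
move=> P0 PL Q0 QL aC aL bL bR lL a0 a00 b0 CQ C0 convC clC.
have [n [e [Pe eP ei]]] := subspace_basis P0 PL.
have [m [h [Qh hQ hi]]] := subspace_basis Q0 QL.
pose E (x : 'rV_n) := \sum_i x 0 i *: e i.
pose H (x : 'rV_m) := \sum_i x 0 i *: h i.
have EL k x y : E (k *: x + y) = k *: E x + E y.
  rewrite /E scaler_sumr -big_split; apply: eq_bigr => i _ /=.
  by rewrite !mxE scalerDl scalerA.
have HL k x y : H (k *: x + y) = k *: H x + H y.
  rewrite /H scaler_sumr -big_split; apply: eq_bigr => i _ /=.
  by rewrite !mxE scalerDl scalerA.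
have HB x y : H (x - y) = H x - H y.
  by rewrite addrC -scaleN1r HL scaleN1r addrC.
have H0 : H 0 = 0 by rewrite -(subrr 0) HB subrr.
pose A : 'M[R]_n := \matrix_(i, j) a (e i) (e j).
pose B : 'M[R]_(m, n) := \matrix_(i, j) b (h i) (e j).
pose c : 'rV[R]_n := \row_j l (e j).
have AE x y : bform A x y = a (E x) (E y).
  rewrite bformE (aC (E x)) (scalar_sum (aL _)); apply: eq_bigr => j _.
  rewrite mulrC aC (scalar_sum (aL _)); congr (_ * _).
  by apply: eq_bigr => i _; rewrite mxE.
have BE x y : bform B x y = b (H x) (E y).
  rewrite bformE (scalar_sum (bR _)); apply: eq_bigr => j _.
  rewrite mulrC (scalar_sum (bL _)); congr (_ * _).
  by apply: eq_bigr => i _; rewrite mxE.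
have cE y : (c *m y^T) 0 0 = l (E y).
  rewrite mxE (scalar_sum lL); apply: eq_bigr => j _.
  by rewrite !mxE mulrC.
have [||||||u [q [Cq uq hq]]] := @saddle_point_mx m n A B c [set x | C (H x)].
- by apply/matrixP => i j; rewrite !mxE aC.
- move=> x x0; rewrite AE lt_neqAle a0 ?andbT; last exact: Pe.
  by apply: contra_neq x0 => /esym/a00 => /(_ (Pe _))/ei.
- move=> q qB; apply: hi; apply: b0; first exact: Qh.
  move=> v /eP[x ->]; rewrite -/(E x) -/(H q) -BE /bform qB.
  by rewrite mul0mx mxE.
- exact: clC.
- by exists 0 => /=; rewrite H0.
- move=> x y t t01 /= Cx Cy.
  rewrite addrC HL HB addrC; exact: convC.
exists (E u), (H q); split=> //; first exact: Pe.
- move=> v /eP[x ->]; rewrite -/(E x) -AE -BE -cE -uq /bform.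
  by rewrite mulmxDl [RHS]mxE.
- move=> q' Cq'; have [y yq] := hQ _ (CQ _ Cq').
  have -> : q' - H q = H (y - q) by rewrite HB yq.
  by rewrite -BE; apply: hq; rewrite /= /H -yq.
Qed.

End saddle.

(** * Integrals of piecewise functions, and volumes *)

Section pieces.
Context (R : realType) (d : measure_display) (T : measurableType d).

Lemma Rintegral_pieces (m : {measure set T -> \bar R}) (I : finType)
    (D : set T) (E : I -> set T) (h : I -> T -> R) (F : T -> R) :
  measurable D -> (forall i, measurable (E i)) ->
  (forall i j, i != j -> E i `&` E j = set0) ->
  (forall i, m.-integrable (D `&` E i) (EFin \o h i)) ->
  (forall i x, D x -> E i x -> F x = h i x) ->
  (forall x, D x -> (forall i, ~ E i x) -> F x = 0) ->
  \int[m]_(x in D) F x = \sum_i \int[m]_(x in D `&` E i) h i x.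
Proof.
move=> mD mE disjE ih FE F0.
have FS : {in D, F =1 (fun x => \sum_i (h i \_ (E i)) x)}.
  move=> x; rewrite inE => Dx.
  have [[i Eix]|nE] := pselect (exists i, E i x); last first.
    rewrite F0//; last by move=> i Eix; apply: nE; exists i.
    rewrite big1// => i _; rewrite patchE memNset// => Eix; apply: nE.
    by exists i.
  rewrite (FE i)// (bigD1 i)//= patchE mem_set// big1 ?addr0// => j ji.
  rewrite patchE memNset// => Ejx.
  by have : (E j `&` E i) x by []; rewrite disjE.
have ih' i : m.-integrable D (EFin \o (h i \_ (E i))).
  rewrite -restrict_EFin; apply/integrable_restrict => //; exact: ih.
rewrite (eq_Rintegral _ FS) /Rintegral.
transitivity (fine (\sum_i \int[m]_(x in D) (EFin \o (h i \_ (E i))) x)%E).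
  congr fine; rewrite -integral_sum//; apply: eq_integral => x _.
  by rewrite /= sumEFin.
rewrite -sum_fine; last by move=> i _; exact: integrable_fin_num.
by apply: eq_bigr => i _; rewrite -[RHS]/(Rintegral _ _ _) Rintegral_mkcondr.
Qed.

End pieces.

Section piecewise.
Context (R : realType) (d : nat) (I : finType) (V : zmodType).
Context (E : I -> set 'cV[R]_d) (q : I -> V).

Lemma piecewise_in i x : (forall i j, i != j -> E i `&` E j = set0) ->
  E i x -> piecewise E q x = q i.
Proof.
move=> disjE Eix; rewrite /piecewise; case: pickP => [j /asboolP Ejx|/(_ i)].
  congr q; apply/eqP/negPn/negP => /disjE ji.
  by have : (E j `&` E i) x by []; rewrite ji.
by move/asboolP.
Qed.

Lemma piecewise_out x : (forall i, ~ E i x) -> piecewise E q x = 0.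
Proof.
by move=> nE; rewrite /piecewise; case: pickP => // j /asboolP /nE.
Qed.

End piecewise.

Section volumes.
Context (R : realType).

Lemma measurable_mx_ball n (c : 'cV[R]_n) r : 0 < r -> measurable (ball c r).
Proof.
move=> r0; have -> : ball c r =
    \bigcap_(i in [set: 'I_n]) ((fun v : 'cV[R]_n => v i 0) @^-1` ball (c i 0) r).
  apply/seteqP; split=> [x [_ xr] i _|x xr]; first exact: xr.
  by split=> // i j; rewrite ord1; exact: xr.
apply: fin_bigcap_measurable; first exact: finite_finset.
move=> i _; rewrite -[X in measurable X]setTI.
by apply: measurable_mx_coord => //; exact: measurable_ball.
Qed.

(** The sigma-algebra is generated by the coordinates, so openness has to be
    turned into a countable union: that of the balls with rational centre and
    radius 1/(k+1) contained in the set. *)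
Lemma open_measurable_mx n (U : set 'cV[R]_n) : open U -> measurable U.
Proof.
move=> oU.
pose B (p : 'cV[rat]_n * nat) : set 'cV[R]_n :=
  ball (map_mx (@ratr R) p.1) p.2.+1%:R^-1.
pose F p := if `[< B p `<=` U >] then B p else set0.
have -> : U = \bigcup_p F p.
  apply/seteqP; split=> [x Ux|x [p _]]; last first.
    by rewrite /F; case: asboolP => // h /h.
  have /nbhs_ballP[e /= e0 eU] : nbhs x U by exact: open_nbhs_nbhs.
  have [k ke] : exists k, k.+1%:R^-1 < e / 2.
    have e2 : 0 < e / 2 by rewrite divr_gt0.
    exists (Num.truncn (e / 2)^-1); rewrite invf_plt ?posrE//.
    exact: truncnS_gt.
  have k0 : 0 < k.+1%:R^-1 :> R by rewrite invr_gt0 ltr0n.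
  have /choice[q xq] : forall i, exists q : rat,
      ball (x i 0) k.+1%:R^-1 (ratr q).
    move=> i; have := @dense_rat R (ball (x i 0) k.+1%:R^-1).
    case; first by exists (x i 0); exact: ballxx.
      exact: ball_open.
    by move=> y [xy [q _ qy]]; exists q; rewrite qy.
  have xB : ball x k.+1%:R^-1 (map_mx (@ratr R) (\col_i q i)).
    by split=> // i j; rewrite ord1 !mxE; exact: xq.
  exists (\col_i q i, k) => //; rewrite /F ifT; first exact: ball_sym.
  apply/asboolP => y By; apply: eU; rewrite [e]splitr.
  by apply: le_ball (ball_triangle xB By); rewrite lerD// ltW.
apply: countable_bigcupT_measurable; first exact: countableP.
move=> p; rewrite /F; case: ifP => // _; apply: measurable_mx_ball.
by rewrite invr_gt0 ltr0n.
Qed.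

Lemma closed_measurable_mx n (U : set 'cV[R]_n) : closed U -> measurable U.
Proof.
move=> cU; rewrite -[U]setCK; apply: measurableC; apply: open_measurable_mx.
exact: closed_openC.
Qed.

(** A ball for the norm of matrices is a cube, whence the induction on the
    dimension along the definition of [lebn]. *)
Lemma lebn_ball n (c : 'cV[R]_n) r : 0 < r ->
  lebn (ball c r) = ((r *+ 2) ^+ n)%:E.
Proof.
move=> r0; elim: n c => [|n IH] c.
  rewrite /= diracE mem_set ?expr0//; split=> // i; by case: i.
have -> : lebn (ball c r) =
    (lebesgue_measure \x @lebn R n)%E (@mx_cons R n @^-1` ball c r) by [].
have -> : @mx_cons R n @^-1` ball c r =
    ball (c 0 0) r `*` ball (dsubmx (c : 'cV[R]_(1 + n))) r.
  have c0 (v : 'cV[R]_n.+1) : v 0 0 = usubmx (v : 'cV[R]_(1 + n)) 0 0.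
    by rewrite mxE; congr (v _ _); apply/val_inj.
  apply/seteqP; split=> -[t v] /=.
    move=> [_ h]; split=> /=.
      have := h 0 0; rewrite [X in ball _ _ X]c0 /mx_cons /= col_mxKu.
      by rewrite mxE eqxx mulr1n.
    split=> // i j; have := h (rshift 1 i : 'I_(1 + n)) j.
    by rewrite /mx_cons /= (@col_mxEd _ 1 n 1) mxE.
  move=> [h0 [_ h]]; split=> // i j; rewrite ord1.
  case: (splitP (i : 'I_(1 + n))) => [k ik|k ik].
    have -> : i = 0 by apply/val_inj; rewrite /= ik ord1.
    by rewrite [X in ball _ _ X]c0 /mx_cons /= col_mxKu mxE eqxx mulr1n.
  have -> : i = rshift 1 k :> 'I_(1 + n) by apply/val_inj.
  have := h k 0; rewrite mxE.
  by rewrite /mx_cons /= (@col_mxEd _ 1 n 1).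
transitivity (lebesgue_measure (ball (c 0 0)%R r) *
    lebn (ball (dsubmx (c : 'cV[R]_(1 + n))) r))%E; last first.
  by rewrite IH lebesgue_measure_ball ?ltW// -EFinM -exprS.
apply: product_measure1E; first exact: measurable_ball.
exact: measurable_mx_ball.
Qed.

Lemma lebn_bounded_fin n (A : set 'cV[R]_n) : measurable A -> bounded_set A ->
  (lebn A < +oo)%E.
Proof.
move=> mA [M [_ AM]].
apply: (@le_lt_trans _ _ (lebn (ball (0 : 'cV[R]_n) (`|M| + 2)))).
  apply: le_measure; rewrite ?inE//; first exact: measurable_mx_ball.
  move=> x Ax; have Mx : `|x| <= `|M| + 1.
    by apply: AM => //; rewrite (le_lt_trans (ler_norm M))// ltrDl.
  by rewrite mx_norm_ball /ball_/= sub0r normrN (le_lt_trans Mx)// ltrD2l ltr1n.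
by rewrite lebn_ball ?ltry.
Qed.

Lemma lebn_open_gt0 n (A U : set 'cV[R]_n) : measurable A -> open U ->
  U !=set0 -> U `<=` A -> (0 < lebn A)%E.
Proof.
move=> mA oU [x Ux] UA.
have /nbhs_ballP[e /= e0 eU] : nbhs x U by exact: open_nbhs_nbhs.
apply: (@lt_le_trans _ _ (lebn (ball x e))).
  by rewrite lebn_ball// lte_fin exprn_gt0// mulrn_wgt0.
apply: le_measure; rewrite ?inE//; first exact: measurable_mx_ball.
exact: subset_trans eU UA.
Qed.

End volumes.

(** * The dot product *)

Section dot_product.
Context (R : realType) (d : nat).
Implicit Types x y n e : 'cV[R]_d.

Lemma dotE x y : dot x y = (x^T *m y) 0 0.
Proof. by rewrite mxE; apply: eq_bigr => i _; rewrite mxE. Qed.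

Lemma dotC x y : dot x y = dot y x.
Proof. by apply: eq_bigr => i _; rewrite mulrC. Qed.

Lemma dotDr x y z : dot x (y + z) = dot x y + dot x z.
Proof. by rewrite !dotE mulmxDr mxE. Qed.

Lemma dotZr k x y : dot x (k *: y) = k * dot x y.
Proof. by rewrite !dotE -scalemxAr mxE. Qed.

Lemma dotNr x y : dot x (- y) = - dot x y.
Proof. by rewrite -scaleN1r dotZr mulN1r. Qed.

Lemma dotBr x y z : dot x (y - z) = dot x y - dot x z.
Proof. by rewrite dotDr dotNr. Qed.

Lemma dotDl x y z : dot (x + y) z = dot x z + dot y z.
Proof. by rewrite -!(dotC z) dotDr. Qed.

Lemma dotZl k x y : dot (k *: x) y = k * dot x y.
Proof. by rewrite -!(dotC y) dotZr. Qed.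

Lemma dotBl x y z : dot (x - y) z = dot x z - dot y z.
Proof. by rewrite -!(dotC z) dotBr. Qed.

Lemma dotr0 x : dot x 0 = 0.
Proof. by rewrite -(scale0r 0) dotZr mul0r. Qed.

Lemma dot0r x : dot 0 x = 0.
Proof. by rewrite dotC dotr0. Qed.

Lemma dot_ge0 x : 0 <= dot x x.
Proof. by apply: sumr_ge0 => i _; rewrite -expr2 sqr_ge0. Qed.

Lemma dot_eq0 x : dot x x = 0 -> x = 0.
Proof.
move=> /eqP; rewrite psumr_eq0; last by move=> i _; rewrite -expr2 sqr_ge0.
move=> /allP xx; apply/colP => i; rewrite mxE.
by have := xx i (mem_index_enum _); rewrite -expr2 sqrf_eq0 => /eqP.
Qed.

Lemma dot_neq0 x : x != 0 -> dot x x != 0.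
Proof. by apply: contra_neq => /dot_eq0. Qed.

Lemma dot_unit n : enorm n = 1 -> dot n n = 1.
Proof.
by move=> n1; rewrite -(sqr_sqrtr (dot_ge0 n)) -/(enorm n) n1 expr1n.
Qed.

Lemma dot_continuous n : continuous (dot n : 'cV[R]_d -> R).
Proof.
apply: continuous_sum => i x.
apply: (@continuousM R 'cV[R]_d (cst (n i 0))); first exact: cst_continuous.
exact: coord_continuous.
Qed.

Lemma common_normal k (A : 'M[R]_(d, k)) : (k < d)%N ->
  exists2 n : 'cV[R]_d, n != 0 & n^T *m A = 0.
Proof.
move=> kd; have : kermx A != 0.
  by rewrite kermx_eq0 -row_leq_rank -ltnNge (leq_ltn_trans (rank_leq_col _)).
have [[i ki] _|k0] := pselect (exists i, row i (kermx A) != 0); last first.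
  move=> /eqP[]; apply/row_matrixP => i; rewrite row0.
  by apply/eqP/negPn/negP => ki; apply: k0; exists i.
exists (row i (kermx A))^T; first by rewrite trmx_eq0.
rewrite trmxK; apply/sub_kermxP; exact: row_sub.
Qed.

(** By skewness B n is orthogonal to n, so B (B n) = 0; by skewness again,
    |B n|^2 = - B (B n) . n = 0, and B vanishes on the normal too. *)
Lemma skew_vanish (B : 'M[R]_d) n : B^T = - B -> enorm n = 1 ->
  (forall e, dot n e = 0 -> B *m e = 0) -> B = 0.
Proof.
move=> skB /dot_unit n1 Be.
have skew x y : dot x (B *m y) = - dot (B *m x) y.
  by rewrite !dotE trmx_mul skB mulmxA mulmxN mulNmx [X in _ = - X]mxE opprK.
have nBn : dot n (B *m n) = 0.
  by have := skew n n; rewrite (dotC (B *m n)) => h; lra.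
have Bn : B *m n = 0.
  by apply: dot_eq0; rewrite skew (Be _ nBn) dot0r oppr0.
have B0 x : B *m x = 0.
  rewrite -(subrK (dot n x *: n) x) mulmxDr -scalemxAr Bn scaler0 addr0.
  by apply: Be; rewrite dotBr dotZr n1 mulr1 subrr.
apply/matrixP => i j; have := congr1 (fun v : 'cV_d => v i 0) (B0 (delta_mx j 0)).
by rewrite -colE !mxE.
Qed.

End dot_product.

(** * Segments, hyperplanes and polytopal domains *)

Lemma connected_meets (T : topologicalType) (A P Q : set T) :
  connected A -> closed P -> closed Q -> A `<=` P `|` Q ->
  A `&` P !=set0 -> A `&` Q !=set0 -> exists x, [/\ A x, P x & Q x].
Proof.
move=> cA cP cQ APQ AP0 [y [Ay Qy]]; apply: contrapT => nPQ.
have APE : A `&` P = A `&` ~` Q.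
  apply/seteqP; split=> x [Ax]; last by move=> nQ; case: (APQ _ Ax).
  by move=> Px; split=> // Qx; apply: nPQ; exists x.
have : A `&` P = A.
  apply: cA => //; last by exists P.
  by exists (~` Q); [exact: closed_openC|].
by rewrite APE => /seteqP[_ /(_ _ Ay)[]].
Qed.

Section segments.
Context (R : realType) (d : nat).
Local Notation pt := 'cV[R]_d.
Implicit Types (p q x e n : pt) (U : set pt).

Lemma line_continuous x e : continuous (fun t : R => x + t *: e).
Proof.
move=> t; apply: cvgD; first exact: cvg_cst.
by apply: cvgZr_tmp; exact: cvg_id.
Qed.

Lemma segment_connected_mx p q :
  connected [set p + t *: (q - p) | t in `[0, 1]%classic].
Proof.
apply: connected_continuous_connected; first exact: segment_connected.
apply: continuous_subspaceT; exact: line_continuous.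
Qed.

Lemma segment_meets p q (A B : set pt) : closed A -> closed B ->
  (forall t, 0 <= t <= 1 -> (A `|` B) (p + t *: (q - p))) -> A p -> B q ->
  exists2 t, 0 <= t <= 1 & A (p + t *: (q - p)) /\ B (p + t *: (q - p)).
Proof.
move=> cA cB AB Ap Bq.
have [|||x [[t /= t01 <-] Ax Bx]] :=
  connected_meets (@segment_connected_mx p q) cA cB.
- by move=> _ [t /= t01 <-]; apply: AB; rewrite in_itv in t01.
- exists p; split=> //; exists 0; first by rewrite /= in_itv /= lexx ler01.
  by rewrite scale0r addr0.
- exists q; split=> //; exists 1; first by rewrite /= in_itv /= lexx ler01.
  by rewrite scale1r addrC subrK.
by exists t => //; rewrite in_itv in t01.
Qed.

Lemma ball_segment x (r : R) p q t : 0 <= t <= 1 -> ball x r p -> ball x r q ->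
  ball x r (p + t *: (q - p)).
Proof.
rewrite mx_norm_ball /ball_/= => /andP[t0 t1] xp xq.
have -> : x - (p + t *: (q - p)) = (1 - t) *: (x - p) + t *: (x - q).
  by apply/matrixP => i j; rewrite !mxE; ring.
rewrite (le_lt_trans (ler_normD _ _))// !normrZ (ger0_norm t0).
rewrite ger0_norm ?subr_ge0//.
have [m [mr mp mq]] : exists m, [/\ m < r, `|x - p| <= m & `|x - q| <= m].
  by exists (Num.max `|x - p| `|x - q|); rewrite gt_max xp xq !le_max !lexx orbT.
by apply: le_lt_trans mr; nra.
Qed.

(** A notion shared by the open sets of the space (E is everything) and the
    relatively open subsets of a hyperplane (E is its direction), which is
    enough to move a point off finitely many hyperplanes. *)
Definition open_along (E U : set pt) : Prop :=
  forall x e, U x -> E e -> \forall t \near (0 : R), U (x + t *: e).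

Lemma open_open_along (E U : set pt) : open U -> open_along E U.
Proof.
move=> oU x e Ux Ee; apply: line_continuous.
by apply: open_nbhs_nbhs; rewrite scale0r addr0.
Qed.

Lemma open_alongI (E U W : set pt) :
  open_along E U -> open_along E W -> open_along E (U `&` W).
Proof.
by move=> oU oW x e [Ux Wx] Ee; apply: filterI; [exact: oU|exact: oW].
Qed.

Lemma open_along_step (E U : set pt) x e : open_along E U -> U x -> E e ->
  exists2 t : R, 0 < t & U (x + t *: e).
Proof.
move=> oU Ux Ee; have /nbhs_ballP[r /= r0 rU] := oU _ _ Ux Ee.
exists (r / 2); first by rewrite divr_gt0.
apply: rU; rewrite /ball /= sub0r normrN gtr0_norm ?divr_gt0//.
by rewrite ltr_pdivrMr// ltr_pMr// ltr1n.
Qed.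

(** One hyperplane at a time: removing it from U leaves a set that is open along
    E, and nonempty since any point of it can be moved transversally. *)
Lemma avoid_hyperplanes (J : finType) (E U : set pt) (n p : J -> pt) :
  U !=set0 -> open_along E U ->
  (forall j x, U x -> dot (n j) (x - p j) = 0 ->
     exists2 e, E e & dot (n j) e != 0) ->
  exists2 x, U x & forall j, dot (n j) (x - p j) != 0.
Proof.
move=> U0 oU nE.
suff : forall s : seq J, exists2 x, U x & forall j, j \in s -> dot (n j) (x - p j) != 0.
  by case/(_ (enum J)) => x Ux nx; exists x => // j; apply: nx; rewrite mem_enum.
move=> s; elim: s U U0 oU nE => [|j s IH] U U0 oU nE.
  by have [x Ux] := U0; exists x.
pose W : set pt := [set x | dot (n j) (x - p j) != 0].
have [|||x [Ux Wx] nx] := IH (U `&` W).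
- have [x Ux] := U0; have [Wx|] := boolP (dot (n j) (x - p j) != 0).
    by exists x.
  rewrite negbK => /eqP nx0; have [e Ee ne] := nE j x Ux nx0.
  have [t t0 Ut] := open_along_step oU Ux Ee.
  exists (x + t *: e); split=> //; rewrite /W/= addrAC dotDr nx0 add0r dotZr.
  by rewrite mulf_neq0// gt_eqF.
- apply: open_alongI => //; apply: open_open_along.
  rewrite (_ : W = (dot (n j) : pt -> R) @^-1` (~` [set dot (n j) (p j)])).
    apply: open_comp; first by move=> x _; exact: dot_continuous.
    by apply: closed_openC; exact: closed_eq.
  apply/seteqP; split=> x; rewrite /W /= dotBr subr_eq0 => /eqP//.
- by move=> i x [Ux _]; exact: nE.
exists x => // i; rewrite inE => /predU1P[->//|]; exact: nx.
Qed.

End segments.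

Section polytopal.
Context (R : realType) (d : nat).
Local Notation pt := 'cV[R]_d.
Context (k : nat) (H A : set pt) (hA : polytopal_domain k H A).

Lemma polytopal_relopen : exists2 O, open O & A = H `&` O.
Proof.
case: hA => _ _ AE _.
exists ([set y | H y -> closure A y]°); first exact: open_interior.
by rewrite [LHS]AE; apply/seteqP; split=> x.
Qed.

Lemma polytopal_bounded : bounded_set (closure A).
Proof.
case: hA => _ _ _ [N [p [_ ->]]].
pose M := \sum_j \sum_i `|p j i|.
exists M; split; first exact: num_real.
move=> r Mr x [j _ [w [w0 _ w1 ->]]]; apply: (le_trans _ (ltW Mr)).
apply: (@le_trans _ _ (\sum_i `|p j i|)); last first.
  rewrite /M (bigD1 j)//= lerDl; apply: sumr_ge0 => *; exact: sumr_ge0.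
apply: (le_trans (ler_norm_sum _ _ _)); apply: ler_sum => i _.
rewrite normrZ ger0_norm// ler_piMl// -w1 (bigD1 i)//= lerDl.
exact: sumr_ge0.
Qed.

Lemma polytopal_nonempty : A !=set0. Proof. by case: hA. Qed.

End polytopal.

(** * Topology of a conforming mesh *)

Section mesh_geometry.
Context (R : realType) (d : nat) (hd : d = 2%N \/ d = 3%N).
Local Notation pt := 'cV[R]_d.
Context (Omega : set pt) (G : fracture_network R d) (M : mesh R d).
Hypothesis hOmega : polytopal_domain d setT Omega.
Hypothesis hG : is_fracture_network Omega G.
Hypothesis hM : is_conforming_mesh Omega G M.
Implicit Types (K L : cell M) (s : face M) (a b : node M).

Let polytopal_open (A : set pt) : polytopal_domain d setT A -> open A.
Proof. by move=> /polytopal_relopen[U oU ->]; rewrite setTI. Qed.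

Lemma cell_open K : open (cell_set K).
Proof. exact: polytopal_open (cell_polyhedral hM K). Qed.

Lemma domain_open : open Omega.
Proof. exact: polytopal_open hOmega. Qed.

Lemma closure_open_meets (A B : set pt) x : closure A x -> open B -> B x ->
  A `&` B !=set0.
Proof. by move=> Ax oB Bx; apply: Ax; exact: open_nbhs_nbhs. Qed.

Lemma closed_frontier (A : set pt) : closed (frontier A).
Proof.
apply: closedI; first exact: closed_closure.
by apply: open_closedC; exact: open_interior.
Qed.

Lemma closure_sub_closed (A B : set pt) : closed B -> A `<=` B -> closure A `<=` B.
Proof. by move=> /closure_id cB /closure_subset; rewrite -cB. Qed.

Lemma cell_closure_eq K L x : cell_set K x -> closure (cell_set L) x -> K = L.
Proof.
move=> Kx Lx; apply/eqP/negPn/negP => /(cell_disjoint hM) KL.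
have [y [Ly Ky]] := closure_open_meets Lx (@cell_open K) Kx.
by have : (cell_set K `&` cell_set L) y by []; rewrite KL.
Qed.

Lemma cell_frontierF K L x : cell_set K x -> ~ frontier (cell_set L) x.
Proof.
move=> Kx [/(cell_closure_eq Kx) <-]; apply.
by apply: open_nbhs_nbhs; split=> //; exact: cell_open.
Qed.

Lemma cell_facesP K s :
  s \in cell_faces K <-> face_set s `<=` frontier (cell_set K).
Proof. by rewrite inE asboolE. Qed.

Lemma closure_face_frontier K s : s \in cell_faces K ->
  closure (face_set s) `<=` frontier (cell_set K).
Proof.
by move=> /cell_facesP; apply: closure_sub_closed; exact: closed_frontier.
Qed.

Lemma face_has_cell s : exists K, s \in cell_faces K.
Proof.
have : (0 < #|face_cells s|)%N.
  by case: (face_adjacency hM s) => -[-> _].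
by move=> /card_gt0P[K]; rewrite finset.in_set => sK; exists K.
Qed.

Lemma cell_faceF K s x : cell_set K x -> ~ closure (face_set s) x.
Proof.
have [L sL] := face_has_cell s.
move=> Kx /(closure_face_frontier sL); exact: (cell_frontierF Kx).
Qed.

Lemma network_faceP x :
  network_closure G x <-> exists2 s, s \in fracture_faces M & closure (face_set s) x.
Proof.
rewrite (fracture_mesh hM); split=> [[s /= sF sx]|[s sF sx]]; by exists s.
Qed.

Lemma network_closed : closed (network_closure G).
Proof.
apply: closed_bigcup; first exact: finite_finset.
by move=> i _; exact: closed_closure.
Qed.

Lemma cell_in_complement K : cell_set K `<=` Omega `\` network_closure G.
Proof.
move=> x Kx; split; first exact: (cell_sub hM Kx).
by move=> /network_faceP[s _]; exact: cell_faceF Kx.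
Qed.

Lemma face_relopen s : exists2 U, open U &
  face_set s = hyperplane (face_normal s) (face_offset s) `&` U.
Proof. exact: polytopal_relopen (face_planar hM s). Qed.

Lemma face_open_along s :
  open_along [set e | dot (face_normal s) e = 0] (face_set s).
Proof.
have [U oU ->] := face_relopen s; move=> x e [Hx Ux] /= e0.
have := @open_open_along _ _ setT _ oU _ e Ux I; apply: filterS => t Ut; split=> //.
by rewrite /hyperplane /= dotDr dotZr e0 mulr0 addr0.
Qed.

Lemma face_nodesP s a : a \in face_nodes s <-> closure (face_set s) (pos a).
Proof. by rewrite inE asboolE. Qed.

Lemma open_segment_ends (p q : pt) :
  closure (open_segment p q) p /\ closure (open_segment p q) q.
Proof.
suff H (x y : pt) : closure (open_segment x y) x.
  split; first exact: H.
  have -> : open_segment p q = open_segment q p; last exact: H.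
  have sub (x y : pt) : open_segment x y `<=` open_segment y x.
    move=> _ [t /andP[t0 t1] ->]; exists (1 - t).
      by rewrite subr_gt0 t1 ltrBlDr ltrDl.
    by rewrite opprB addrCA subrr addr0 addrC.
  by apply/seteqP; split; exact: sub.
move=> B /= xB; have oB : open_along [set y - x] [set t | B° t].
  exact: open_open_along (open_interior _).
have /nbhs_ballP[r /= r0 rU] := oB _ _ (xB : B° x) erefl.
pose t := Num.min (r / 2) (1 / 2).
have t0 : 0 < t by rewrite lt_min !divr_gt0.
have tr : t < r by rewrite gt_min ltr_pdivrMr// ltr_pMr// ltr1n.
have t1 : t < 1 by rewrite gt_min [X in _ || X]ltr_pdivrMr// mul1r ltr1n orbT.
exists (x + t *: (y - x)); split.
  exists t; first by rewrite t0.
  by rewrite scalerBr scalerBl scale1r addrA addrAC.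
by apply: nbhs_singleton; apply: rU; rewrite /ball/= sub0r normrN gtr0_norm.
Qed.

Lemma closed_segment_closed (p q : pt) :
  closed [set p + t *: (q - p) | t in `[0 : R, 1]%classic].
Proof.
apply: compact_closed; first exact: norm_hausdorff.
apply: continuous_compact; last exact: segment_compact.
by apply: continuous_subspaceT; exact: line_continuous.
Qed.

(** In dimension 2 a face is an edge and its boundary consists of two nodes; in
    dimension 3 its boundary is made of edges. The position of the boundary
    point on the line through the nodes is recorded dually, by the affine forms
    that are constant on these nodes. *)
Lemma face_boundary_nodes s z : face_boundary s z ->
  exists a b, [/\ a \in face_nodes s, b \in face_nodes s, d = 2%N -> a = b &
    forall n c, dot n (pos a) = c -> dot n (pos b) = c -> dot n z = c].
Proof.
have ends (e : edge M) : edge_set e `<=` closure (face_set s) ->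
    edge_tail e \in face_nodes s /\ edge_head e \in face_nodes s.
  move=> es; have [tl hd'] := open_segment_ends (pos (edge_tail e)) (pos (edge_head e)).
  have ces : closure (edge_set e) `<=` closure (face_set s).
    by apply: closure_sub_closed => //; exact: closed_closure.
  by split; apply: (face_nodesP _ _).2; apply: ces; [exact: tl|exact: hd'].
case: hd => d23.
  have [/(_ s)[e se] _] := face_edges2 hM d23.
  have [|tl hd'] := ends e; first by rewrite -se; exact: subset_closure.
  move=> [zs nzs].
  have [t t01 tz] : [set pos (edge_tail e) + t *: (pos (edge_head e) - pos (edge_tail e))
      | t in `[0 : R, 1]%classic] z.
    move: z zs {nzs}; apply: closure_sub_closed; first exact: closed_segment_closed.
    rewrite se => _ [t /andP[t0 t1] ->].
    exists t; first by rewrite /= in_itv /= !ltW.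
    by rewrite scalerBr scalerBl scale1r addrA addrAC.
  move: t01; rewrite /= in_itv /= le_eqVlt => /andP[/predU1P[t0|t0]].
    exists (edge_tail e), (edge_tail e); split=> // n c + _.
    by rewrite -tz -t0 scale0r addr0.
  rewrite le_eqVlt => /predU1P[t1|t1].
    exists (edge_head e), (edge_head e); split=> // n c + _.
    by rewrite -tz t1 scale1r addrC subrK.
  case: nzs; rewrite se -tz; exists t; first by rewrite t0.
  by rewrite scalerBr scalerBl scale1r addrA addrAC.
have [/(_ s) -> _] := face_edges3 hM d23.
move=> [e /= es ez].
have [|tl hd'] := ends e; first by apply: subset_trans es _ => x [].
exists (edge_tail e), (edge_head e); split=> //; first by move=> d2; have := etrans (esym d2) d23.
move=> n c na nb.
have cH : closed [set x | dot n x = c].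
  apply: (@preimage_closed _ _ (dot n : pt -> R) [set c]).
    by move=> x _; exact: dot_continuous.
  exact: closed_eq.
suff : closure (edge_set e) `<=` [set x | dot n x = c] by exact.
apply: closure_sub_closed => // _ [t _ ->]; rewrite /= dotDr !dotZr na nb; ring.
Qed.

(** Some hyperplane through p contains the nodes a and b; in dimension 2 this
    needs a = b. *)
Let normal2 a b (p : pt) : exists n : pt, n != 0 /\
  ((d = 2%N -> a = b) -> dot n (pos a - p) = 0 /\ dot n (pos b - p) = 0).
Proof.
pose u := pos a - p; pose v := pos b - p.
have [ab|ab] := eqVneq a b.
  have d1 : (1 < d)%N by case: hd => ->.
  have [n n0 nu] := common_normal u d1; exists n; split=> // _.
  by rewrite -ab dotE nu mxE.
have [d2|d2] := eqVneq d 2%N.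
  have d0 : (0 < d)%N by case: hd => ->.
  have [n n0 _] := common_normal (0 : 'M[R]_(d, 0)) d0.
  by exists n; split=> // /(_ d2)/eqP; rewrite (negbTE ab).
have d3 : (1 + 1 < d)%N by case: hd d2 => ->.
have [n n0] := common_normal (row_mx u v) d3.
rewrite mul_mx_row => nuv; exists n; split=> // _; rewrite !dotE.
by split; [rewrite -(row_mxKl (n^T *m u) (n^T *m v))|
  rewrite -(row_mxKr (n^T *m u) (n^T *m v))]; rewrite nuv !mxE.
Qed.

Let face_boundary_normals p : exists n : node M * node M -> pt,
  (forall ab, n ab != 0) /\
  forall s z, face_boundary s z -> exists ab, dot (n ab) (z - p) = 0.
Proof.
have /choice[n hn] : forall ab : node M * node M, exists n : pt, n != 0 /\
    ((d = 2%N -> ab.1 = ab.2) ->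
     dot n (pos ab.1 - p) = 0 /\ dot n (pos ab.2 - p) = 0).
  by move=> [a b]; exact: normal2.
exists n; split=> [ab|s z]; first by case: (hn ab).
move=> /face_boundary_nodes[a [b [_ _ dab zab]]].
exists (a, b); have [_ /(_ dab)] := hn (a, b).
rewrite /= !dotBr => -[/subr0_eq na /subr0_eq nb].
by rewrite (zab _ _ na nb) subrr.
Qed.

(** For any p, the boundaries of the faces are covered by finitely many
    hyperplanes through p. Choose p in U off such hyperplanes through the
    origin, hence off the boundaries, and then q in W off those through p: a
    point of the segment on the boundary of a face can only be p. *)
Lemma generic_segment (U W : set pt) : open U -> U !=set0 -> open W -> W !=set0 ->
  exists p q, [/\ U p, W q &
    forall t s, 0 <= t <= 1 -> ~ face_boundary s (p + t *: (q - p))].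
Proof.
move=> oU U0 oW W0.
have [n0 [n00 hn0]] := face_boundary_normals 0.
have [|p Up np] := avoid_hyperplanes (n := n0) (p := fun=> 0) U0
    (open_open_along (E := setT) oU).
  by move=> ab _ _ _; exists (n0 ab) => //; apply: dot_neq0 (n00 ab).
have [n [nn0 hn]] := face_boundary_normals p.
have [|q Wq nq] := avoid_hyperplanes (n := n) (p := fun=> p) W0
    (open_open_along (E := setT) oW).
  by move=> ab _ _ _; exists (n ab) => //; apply: dot_neq0 (nn0 ab).
exists p, q; split=> // t s /andP[t0 t1] fb.
have [ab] := hn _ _ fb.
rewrite addrAC subrr add0r dotZr => /eqP.
rewrite mulf_eq0 (negbTE (nq ab)) orbF => /eqP t00.
have [ab'] := hn0 _ _ fb; rewrite t00 scale0r addr0 => /eqP.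
by rewrite (negbTE (np ab')).
Qed.

(** A point in the closures of two cells is on the frontier of both, and off the
    boundaries of the faces it belongs to a single face. *)
Lemma common_face K L z : K != L -> closure (cell_set K) z -> closure (cell_set L) z ->
  (forall s, ~ face_boundary s z) ->
  exists s, [/\ face_set s z, s \in cell_faces K & s \in cell_faces L].
Proof.
have face_of K' L' : K' != L' -> closure (cell_set K') z -> closure (cell_set L') z ->
    (forall s, ~ face_boundary s z) -> exists2 s, face_set s z & s \in cell_faces K'.
  move=> KL Kz Lz nfb; have : frontier (cell_set K') z.
    split=> // /interior_subset/cell_closure_eq/(_ Lz)/eqP; exact/negP.
  rewrite (cell_frontier hM) => -[s /= sK sz]; exists s => //.
  by apply: contrapT => nsz; apply: (nfb s).
move=> KL Kz Lz nfb; have [s sz sK] := face_of _ _ KL Kz Lz nfb.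
have [|t tz tL] := face_of L K _ Lz Kz nfb; first by rewrite eq_sym.
exists s; split=> //; suff -> : s = t by [].
apply/eqP/negPn/negP => /(face_disjoint hM) st.
by have : (face_set s `&` face_set t) z by []; rewrite st.
Qed.

Lemma domain_in_cells x : closure Omega x -> exists K, closure (cell_set K) x.
Proof. by rewrite (cell_cover hM) => -[K _ Kx]; exists K. Qed.

(** Near a point of the complement of the network, a generic segment between two
    cells crosses faces at inner points only, and none of these faces is in the
    network; so the cells that come close to this point all satisfy P or all
    fail it. The complement of the network is then covered by two disjoint
    relatively closed sets, and it is connected. *)
Lemma cells_connected (P : cell M -> Prop) :
  (forall s K L, s \notin fracture_faces M -> s \in cell_faces K ->
     s \in cell_faces L -> P K -> P L) ->
  forall K L, P K -> P L.
Proof.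
move=> Pstep K L PK; apply: contrapT => nPL.
pose CP := \bigcup_(K in [set K | P K]) closure (cell_set K).
pose CN := \bigcup_(K in [set K | ~ P K]) closure (cell_set K).
have cCP : closed CP.
  by apply: closed_bigcup; [exact: finite_finset|move=> *; exact: closed_closure].
have cCN : closed CN.
  by apply: closed_bigcup; [exact: finite_finset|move=> *; exact: closed_closure].
have cover x : Omega x -> (CP `|` CN) x.
  move=> /(@subset_closure _ Omega)/domain_in_cells[K' xK'].
  by have [PK'|PK'] := pselect (P K'); [left|right]; exists K'.
have [|||x [[Ox nx] [K' PK' xK'] [L' nPL' xL']]] :=
    connected_meets (complement_connected hG) cCP cCN.
- by move=> x [/cover].
- have [x Kx] := polytopal_nonempty (cell_polyhedral hM K).
  exists x; split; first exact: cell_in_complement Kx.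
  by exists K => //; exact: subset_closure.
- have [x Lx] := polytopal_nonempty (cell_polyhedral hM L).
  exists x; split; first exact: cell_in_complement Lx.
  by exists L => //; exact: subset_closure.
have oC : open (Omega `\` network_closure G).
  by apply: openI; [exact: domain_open|exact: closed_openC network_closed].
have /nbhs_ballP[r /= r0 rC] : nbhs x (Omega `\` network_closure G).
  exact: open_nbhs_nbhs.
have meets K'' : closure (cell_set K'') x -> cell_set K'' `&` ball x r !=set0.
  move=> xK; apply: (closure_open_meets xK (ball_open _ _)); exact: ballxx.
have [p [q [[Kp Bp] [Lq Bq] npq]]] := generic_segment
  (openI (@cell_open K') (@ball_open _ _ x r)) (meets _ xK')
  (openI (@cell_open L') (@ball_open _ _ x r)) (meets _ xL').
have [|||t t01 [[K1 PK1 zK1] [L1 nPL1 zL1]]] := segment_meets (p := p) (q := q) cCP cCN.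
- move=> t t01; have /rC[/cover//] := ball_segment t01 Bp Bq.
- by exists K' => //; exact: (subset_closure Kp).
- by exists L' => //; exact: (subset_closure Lq).
have KL1 : K1 != L1 by apply: contra_notN nPL1 => /eqP <-.
have [s [sz sK sL]] := common_face KL1 zK1 zL1 (fun s => npq t s t01).
apply: nPL1; apply: (Pstep s K1) => //; apply/negP => sF.
have /rC[_] := ball_segment t01 Bp Bq; apply; apply/network_faceP.
by exists s => //; exact: subset_closure sz.
Qed.

(** The point where a generic segment leaves the domain is inside a face. *)
Lemma boundary_face_exists : exists2 s, face_set s `<=` frontier Omega &
  exists K, s \in cell_faces K.
Proof.
have [B [_ OB]] := polytopal_bounded hOmega.
pose far : pt := const_mx (`|B| + 2).
have d0 : (0 < d)%N by case: hd => ->.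
have nfar : (~` closure Omega) far.
  move=> /(OB _ (ltr_pwDr (ltr01 : 0 < 1 :> R) (ler_norm B))) /= farB.
  have := le_trans (le_mx_norm far (Ordinal d0) 0) farB.
  by rewrite mxE ger0_norm ?addr_ge0//; lra.
have [p [q [Op nq npq]]] := generic_segment domain_open
  (polytopal_nonempty hOmega) (closed_openC (@closed_closure _ Omega))
  (ex_intro _ _ nfar).
have [|||t t01 [Oz nOz]] := segment_meets (p := p) (q := q)
    (@closed_closure _ Omega) (open_closedC domain_open).
- move=> t t01; have [Oz|] := pselect (Omega (p + t *: (q - p))); last by right.
  by left; exact: (subset_closure Oz).
- exact: (subset_closure Op).
- by move=> /(@subset_closure _ Omega).
have [K zK] := domain_in_cells Oz.
have : frontier (cell_set K) (p + t *: (q - p)).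
  split=> [|Kz]; first exact: zK.
  by apply: nOz; apply: (cell_sub hM (K := K)); exact: interior_subset Kz.
rewrite (cell_frontier hM) => -[s /= sK sz]; exists s; last by exists K.
have {}sz : face_set s (p + t *: (q - p)).
  by apply: contrapT => nsz; apply: (npq t s t01); split; [exact: sz|exact: nsz].
by case: (face_adjacency hM s) => -[_ sO]; [exact: sO|case: nOz; exact: sO sz].
Qed.

Lemma boundary_face_nodes s a : face_set s `<=` frontier Omega ->
  a \in face_nodes s -> frontier Omega (pos a).
Proof.
move=> sO /face_nodesP; apply: closure_sub_closed => //; exact: closed_frontier.
Qed.

Lemma face_nodes_cell_nodes s K a : s \in cell_faces K -> a \in face_nodes s ->
  a \in cell_nodes K.
Proof.
move=> sK /face_nodesP /(closure_face_frontier sK)[Ka _].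
by rewrite inE asboolE.
Qed.

(** Off the network and off the boundaries of all faces, the face has points
    arbitrarily close to each of its nodes; a small ball around such a point is
    in the complement of the network and meets the cells on both sides. *)
Lemma same_side_face s K L a : s \notin fracture_faces M -> K != L ->
  s \in cell_faces K -> s \in cell_faces L -> a \in face_nodes s ->
  same_side Omega G a K L.
Proof.
move=> sF KL sK sL /face_nodesP sa r r0.
have sO : face_set s `<=` Omega.
  case: (face_adjacency hM s) => -[cs sO] //.
  have [J sJ] : exists J, face_cells s = [set J]%SET by apply/cards1P; rewrite cs.
  have mem I : s \in cell_faces I -> I = J.
    by move=> sI; apply/set1P; rewrite -sJ finset.in_set.
  by move: KL; rewrite (mem _ sK) (mem _ sL) eqxx.
pose nu := face_normal s; have nu1 := dot_unit (face_normal_unit hM s).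
have [x0 sx0] := polytopal_nonempty (face_planar hM s).
have onH x : face_set s x -> dot nu x = face_offset s.
  by have [U _ ->] := face_relopen s; case.
(* The point p is off the plane of the face, so that no hyperplane through p
   contains this plane. *)
pose p := x0 + nu.
have [n [n0 hn]] := face_boundary_normals p.
have U0 : face_set s `&` ball (pos a) r !=set0.
  by apply: (closure_open_meets sa (ball_open _ _)); exact: ballxx.
have [|z [sz az] nz] := avoid_hyperplanes (n := n) (p := fun=> p) U0
    (open_alongI (@face_open_along s) (open_open_along (@ball_open _ _ (pos a) r))).
  move=> ab x [sx _] nx0; pose e := n ab - dot nu (n ab) *: nu.
  have nue : dot nu e = 0 by rewrite dotBr dotZr nu1 mulr1 subrr.
  exists e => //; have -> : dot (n ab) e = dot e e.
    by rewrite {2}/e dotBl dotZl nue mulr0 subr0.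
  apply: dot_neq0; apply: contra_neq (n0 ab) => /subr0_eq ne.
  suff k0 : dot nu (n ab) = 0 by rewrite ne k0 scale0r.
  have := nx0; rewrite [in X in X -> _]ne dotZl dotBr /p dotDr.
  by rewrite (onH _ sx) (onH _ sx0) nu1; lra.
have zO : (Omega `\` network_closure G) z.
  split; first exact: sO.
  move=> /network_faceP[t tF tz].
  have st : s != t by apply: contraNneq sF => ->.
  have : face_set t z.
    apply: contrapT => ntz; have [ab] : exists ab, dot (n ab) (z - p) = 0.
      by apply: (hn t z); split; [exact: tz|exact: ntz].
    by move=> /eqP; rewrite (negbTE (nz ab)).
  by move=> tz'; have : (face_set s `&` face_set t) z by []; rewrite (face_disjoint hM st).
have oC : open ((Omega `\` network_closure G) `&` ball (pos a) r).
  apply: openI; last exact: ball_open.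
  by apply: openI; [exact: domain_open|exact: closed_openC network_closed].
have /nbhs_ballP[e /= e0 eC] : nbhs z ((Omega `\` network_closure G) `&` ball (pos a) r).
  exact: open_nbhs_nbhs.
have meets J : s \in cell_faces J -> cell_set J `&` ball z e !=set0.
  move=> /cell_facesP /(_ _ sz)[Jz _].
  by apply: (closure_open_meets Jz (ball_open _ _)); exact: ballxx.
have [x [Kx ex]] := meets _ sK; have [y [Ly ey]] := meets _ sL.
exists x, y; split=> //.
exists [set x + t *: (y - x) | t in `[0, 1]%classic].
  split; last exact: segment_connected_mx.
    by exists 0; rewrite ?scale0r ?addr0//= in_itv /= lexx ler01.
  by move=> _ [t t01 <-]; apply: eC; apply: ball_segment => //; rewrite /= in_itv in t01.
by exists 1; rewrite ?scale1r /= ?in_itv /= ?lexx ?ler01// addrC subrK.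
Qed.

(** Because the face is bounded. Applied in two opposite directions, this puts
    every point of the face between two points of its boundary. *)
Lemma face_exit s x e : face_set s x -> e != 0 -> dot (face_normal s) e = 0 ->
  exists2 t : R, 0 < t & face_boundary s (x + t *: e).
Proof.
move=> sx e0 nue.
have [B [_ sB]] := polytopal_bounded (face_planar hM s).
have {}sB := sB _ (ltr_pwDr (ltr01 : 0 < 1 :> R) (ler_norm B)).
have [U oU sU] := face_relopen s.
have en : 0 < `|e| by rewrite normr_gt0.
(* After time T the line is out of the ball that contains the face. *)
pose T := (`|B| + 1 + `|x| + 1) / `|e|.
have T0 : 0 < T by rewrite divr_gt0// ltr_wpDl// !addr_ge0.
have Hx t : hyperplane (face_normal s) (face_offset s) (x + t *: e).
  have : face_set s x by []; rewrite sU => -[Hx _].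
  by rewrite /hyperplane /= dotDr dotZr nue mulr0 addr0.
have qE t : x + t *: (x + T *: e - x) = x + (t * T) *: e.
  by rewrite [x + _ - x]addrAC subrr add0r scalerA.
have [|||t /andP[t0 t1]] := segment_meets (p := x) (q := x + T *: e)
    (@closed_closure _ (face_set s)) (open_closedC oU).
- move=> t t01; have [Uz|] := pselect (U (x + t *: (x + T *: e - x))); last by right.
  by left; apply: subset_closure; rewrite sU; split=> //; rewrite qE; exact: Hx.
- exact: (subset_closure sx).
- move=> Uq; have /subset_closure/sB /= : face_set s (x + T *: e) by rewrite sU.
  have := ler_normD (x + T *: e) (- x).
  rewrite addrAC subrr add0r normrN normrZ gtr0_norm// divfK ?gt_eqF//; lra.
rewrite qE => -[cz nUz]; exists (t * T); last first.
  by split=> //; rewrite sU => -[_]; exact: nUz.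
rewrite mulr_gt0// lt_neqAle t0 andbT eq_sym; apply/eqP => t00.
by apply: nUz; rewrite t00 mul0r scale0r addr0; move: sx; rewrite sU => -[].
Qed.

(** A rigid motion that vanishes at the nodes of a face vanishes on the boundary
    of the face, hence on the face, whose points are between two boundary
    points; so its gradient is zero on the plane of the face. *)
Lemma rigid_motion_face_eq0 (B : 'M[R]_d) (x0 w : pt) s : B^T = - B ->
  (forall a, a \in face_nodes s -> B *m (pos a - x0) + w = 0) -> B = 0 /\ w = 0.
Proof.
move=> skB Ba; pose nu := face_normal s.
have nu1 := face_normal_unit hM s.
pose phi x := B *m (x - x0) + w.
have phiD x e : phi (x + e) = phi x + B *m e.
  by rewrite /phi (addrAC x) mulmxDr addrAC.
have phi_fb z : face_boundary s z -> phi z = 0.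
  move=> /face_boundary_nodes[a [b [/Ba na /Ba nb _ zab]]].
  have phiE x i : phi x i 0 = dot (row i B)^T x - ((B *m x0) i 0 - w i 0).
    rewrite /phi mulmxBr !mxE opprB addrA addrAC; congr (_ + _ + _).
    by apply: eq_bigr => j _; rewrite !mxE.
  apply/colP => i; rewrite phiE [RHS]mxE; apply/eqP; rewrite subr_eq0; apply/eqP.
  apply: zab; apply/eqP; rewrite -subr_eq0 -phiE.
    by rewrite /phi na mxE.
  by rewrite /phi nb mxE.
have phi_s x : face_set s x -> phi x = 0.
  move=> sx; have d1 : (1 < d)%N by case: hd => ->.
  have [e e0 eu] := common_normal nu d1.
  have nue : dot nu e = 0 by rewrite dotC dotE eu mxE.
  have [t t0 /phi_fb] := face_exit sx e0 nue.
  have [||t' t0' /phi_fb] := face_exit (e := - e) sx.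
  - by rewrite oppr_eq0.
  - by rewrite dotNr nue oppr0.
  rewrite !phiD -!scalemxAr mulmxN => h1 h2.
  have : (t + t') *: phi x = 0.
    have -> : (t + t') *: phi x =
        t' *: (phi x + t *: (B *m e)) + t *: (phi x + t' *: - (B *m e)).
      by apply/matrixP => i j; rewrite !mxE; ring.
    by rewrite h1 h2 !scaler0 addr0.
  move/eqP; rewrite scaler_eq0 gt_eqF ?addr_gt0//= => /eqP//.
have [x sx] := polytopal_nonempty (face_planar hM s).
have B0 : B = 0.
  apply: (skew_vanish skB nu1) => e nue.
  have [t t0 /phi_s] := open_along_step (@face_open_along s) sx nue.
  rewrite phiD (phi_s _ sx) add0r -scalemxAr => /eqP.
  by rewrite scaler_eq0 gt_eqF//= => /eqP.
by split=> //; have := phi_s _ sx; rewrite /phi B0 mul0mx add0r.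
Qed.

End mesh_geometry.

(** * Measures of domains and of relatively open sets of hyperplanes *)

Section mesh_measures.
Context (R : realType) (d : nat).
Local Notation pt := 'cV[R]_d.
Implicit Types (nu : pt) (A U : set pt).

Lemma hyperplane_closed nu c : closed (hyperplane nu c).
Proof.
apply: (@preimage_closed _ _ (dot nu : pt -> R) [set c]).
  by move=> x _; exact: dot_continuous.
exact: closed_eq.
Qed.

Lemma polytopal_measurable k (H A : set pt) : closed H -> polytopal_domain k H A ->
  measurable A.
Proof.
move=> cH /polytopal_relopen[U oU ->]; apply: measurableI.
  exact: closed_measurable_mx.
exact: open_measurable_mx.
Qed.

Lemma polytopal_bounded_set k (H A : set pt) : polytopal_domain k H A -> bounded_set A.
Proof.
move=> /polytopal_bounded[B [Br AB]]; exists B; split=> // r Br' x Ax.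
by apply: (AB r Br'); exact: subset_closure.
Qed.

Lemma domain_lebn_gt0 A : polytopal_domain d setT A -> (0 < lebn A)%E.
Proof.
move=> hA; have [U oU AU] := polytopal_relopen hA; rewrite setTI in AU.
apply: (@lebn_open_gt0 _ _ _ A) => //.
- apply: polytopal_measurable hA; exact: closedT.
- by rewrite AU.
- exact: polytopal_nonempty hA.
Qed.

Lemma domain_lebn_fin A : polytopal_domain d setT A -> (lebn A < +oo)%E.
Proof.
move=> hA; apply: lebn_bounded_fin; last exact: polytopal_bounded_set hA.
apply: polytopal_measurable hA; exact: closedT.
Qed.

Lemma surface_fin nu c A : measurable A -> bounded_set A -> (surface nu c A < +oo)%E.
Proof.
move=> mA [B [_ AB]]; apply: lebn_bounded_fin.
  apply: measurableI; first exact: measurable_slab.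
  by rewrite -[X in measurable X]setTI; apply: measurable_hyperplane_proj.
exists (`|B| + 1 + `|nu|); split; first exact: num_real.
move=> r Br x [/andP[x0 x1] Ax]; apply: le_trans (ltW Br).
rewrite -(subrK ((dot nu x - c) *: nu) x) (le_trans (ler_normD _ _))//.
apply: lerD; first exact: (AB _ (ltr_pwDr (ltr01 : 0 < 1 :> R) (ler_norm B)) _ Ax).
by rewrite normrZ ger0_norm// ler_piMl.
Qed.

(** The part of the slab that projects into U is open, so the volume that defines
    the surface measure is positive. *)
Lemma surface_gt0 nu c A U : enorm nu = 1 -> measurable A -> open U ->
  hyperplane nu c `&` U !=set0 -> hyperplane nu c `&` U `<=` A ->
  (0 < surface nu c A)%E.
Proof.
move=> /dot_unit nu1 mA oU [x0 [Hx0 Ux0]] UA.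
have projH x : hyperplane nu c (hyperplane_proj nu c x).
  by rewrite /hyperplane /= /hyperplane_proj dotBr dotZr nu1; ring.
have cdot : continuous (fun x : pt => dot nu x - c).
  move=> x; apply: (@continuousB _ _ _ (dot nu : pt -> R) (cst c)).
    exact: dot_continuous.
  exact: cst_continuous.
have cproj : continuous (hyperplane_proj nu c).
  move=> x.
  apply: (@continuousB _ _ _ (@idfun pt) (fun x => (dot nu x - c) *: nu)).
    exact: cvg_id.
  exact: (@cvgZr_tmp _ _ _ (nbhs x) _ _ _ nu (cdot x)).
pose I : set R := [set y | c < y] `&` [set y | y < c + 1].
pose V := ((dot nu : pt -> R) @^-1` I) `&` (hyperplane_proj nu c @^-1` U).
apply: (@lebn_open_gt0 _ _ _ V).
- apply: measurableI; first exact: measurable_slab.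
  by rewrite -[X in measurable X]setTI; apply: measurable_hyperplane_proj.
- apply: openI; apply: open_comp.
  + by move=> x _; exact: dot_continuous.
  + by apply: openI; [exact: open_gt|exact: open_lt].
  + by move=> x _; exact: cproj.
  + exact: oU.
- exists (x0 + 2^-1 *: nu); split.
    rewrite /I /= dotDr dotZr nu1 Hx0; split; lra.
  rewrite /= /hyperplane_proj dotDr dotZr nu1 Hx0.
  by rewrite (_ : c + 2^-1 * 1 - c = 2^-1) ?addrK//; ring.
- move=> x [[cx xc] Ux]; split.
    by rewrite /slab /=; move: cx xc => /=; lra.
  by apply: UA; split=> //; exact: projH.
Qed.

Lemma cst_integrable (m : {measure set pt -> \bar R}) A (r : R) : measurable A ->
  (m A < +oo)%E -> m.-integrable A (EFin \o cst r).
Proof.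
move=> mA Aoo; apply: measurable_bounded_integrable => //.
exists `|r|; split; first exact: num_real.
by move=> y ry x _ /=; exact: ltW.
Qed.

Lemma dot_le_norm (x : pt) : dot x x <= d%:R * `|x| ^+ 2.
Proof.
rewrite mulr_natl -[X in _ *+ X]card_ord -sumr_const; apply: ler_sum => i _.
rewrite -expr2 -real_normK ?num_real// lerXn2r ?nnegrE//.
exact: le_mx_norm.
Qed.

Lemma diam_gt0 (A : set pt) : (0 < d)%N -> open A -> A !=set0 -> bounded_set A ->
  0 < diam A.
Proof.
move=> d0 oA [x Ax] [B [_ AB]].
have {}AB y := AB _ (ltr_pwDr (ltr01 : 0 < 1 :> R) (ler_norm B)) y.
pose e : pt := const_mx 1.
have e0 : e != 0.
  apply/eqP => /colP/(_ (Ordinal d0)); rewrite !mxE => /eqP.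
  by rewrite oner_eq0.
have [t t0 At] := open_along_step (open_open_along (E := setT) oA) Ax (I : setT e).
have xt : 0 < enorm (x + t *: e - x).
  rewrite addrAC subrr add0r sqrtr_gt0 lt_neqAle dot_ge0 andbT eq_sym.
  by apply: dot_neq0; rewrite scaler_eq0 gt_eqF.
apply: (lt_le_trans xt); apply: ub_le_sup; last first.
  by exists (x + t *: e) => //; exists x.
exists (Num.sqrt (d%:R * (2 * (`|B| + 1)) ^+ 2)) => _ [y Ay [z Az <-]].
rewrite ler_wsqrtr// (le_trans (dot_le_norm _))// ler_wpM2l//.
rewrite lerXn2r ?nnegrE ?mulr_ge0 ?addr_ge0//.
by have := ler_normB y z; have /= := AB _ Ay; have /= := AB _ Az; lra.
Qed.

End mesh_measures.

(** * The energy is positive definite *)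

Section tensors.
Context (R : realType) (d : nat).
Implicit Types A B C : 'M[R]_d.

Lemma frobeniusC A B : frobenius A B = frobenius B A.
Proof. by apply: eq_bigr => i _; apply: eq_bigr => j _; rewrite mulrC. Qed.

Lemma frobeniusDl A B C : frobenius (A + B) C = frobenius A C + frobenius B C.
Proof.
rewrite /frobenius -big_split; apply: eq_bigr => i _; rewrite -big_split.
by apply: eq_bigr => j _; rewrite /= mxE mulrDl.
Qed.

Lemma frobeniusZl k A B : frobenius (k *: A) B = k * frobenius A B.
Proof.
rewrite /frobenius mulr_sumr; apply: eq_bigr => i _; rewrite mulr_sumr.
by apply: eq_bigr => j _; rewrite mxE mulrA.
Qed.

Lemma frobenius_scalar_mx k B : frobenius k%:M B = k * \tr B.
Proof.
rewrite /frobenius /mxtrace mulr_sumr; apply: eq_bigr => i _.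
rewrite (bigD1 i)//= mxE eqxx mulr1n big1 ?addr0// => j ji.
by rewrite mxE eq_sym (negbTE ji) mul0r.
Qed.

Lemma frobenius_ge0 A : 0 <= frobenius A A.
Proof. by do 2!apply: sumr_ge0 => ? _; rewrite -expr2 sqr_ge0. Qed.

Lemma frobenius_eq0 A : frobenius A A = 0 -> A = 0.
Proof.
move=> /psumr_eq0P A0; apply/matrixP => i j; rewrite mxE.
have /psumr_eq0P/(_ j erefl)/eqP : \sum_j A i j * A i j = 0.
  by apply: A0 => // k _; apply: sumr_ge0 => ? _; rewrite -expr2 sqr_ge0.
by rewrite -expr2 sqrf_eq0 => h; apply/eqP/h => ? _; rewrite -expr2 sqr_ge0.
Qed.

Lemma trace_sq_le A : (0 < d)%N -> (\tr A) ^+ 2 <= d%:R * frobenius A A.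
Proof.
move=> d0; have D0 : 0 < d%:R :> R by rewrite ltr0n.
(* The diagonal entries satisfy the Cauchy-Schwarz inequality, here in the form
   of the nonnegativity of their variance. *)
pose S := \sum_i A i i ^+ 2.
have SF : S <= frobenius A A.
  apply: ler_sum => i _; rewrite (bigD1 i)//= -expr2 lerDl.
  by apply: sumr_ge0 => j _; rewrite -expr2 sqr_ge0.
suff : (\tr A) ^+ 2 <= d%:R * S by move=> /le_trans; apply; rewrite ler_pM2l.
pose t := \tr A.
have : 0 <= \sum_i (d%:R * A i i - t) ^+ 2 by apply: sumr_ge0 => i _; exact: sqr_ge0.
have -> : \sum_i (d%:R * A i i - t) ^+ 2 = d%:R * (d%:R * S - t ^+ 2).
  transitivity (\sum_i (d%:R ^+ 2 * A i i ^+ 2 - (2 * d%:R * t) * A i i + t ^+ 2)).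
    by apply: eq_bigr => i _; ring.
  have cst : \sum_(i < d) t ^+ 2 = d%:R * t ^+ 2.
    by rewrite sumr_const card_ord mulr_natl.
  rewrite big_split /= cst sumrB -!mulr_sumr -/S (_ : \sum_i A i i = t)//.
  ring.
by rewrite pmulr_rge0// subr_ge0.
Qed.

(** A negative l is compensated by m through the bound on the trace. *)
Lemma lame_form_ge A (m l : R) : (0 < d)%N -> 0 < m -> 0 < 2 * m + d%:R * l ->
  exists2 k, 0 < k & k * frobenius A A <= 2 * m * frobenius A A + l * (\tr A) ^+ 2.
Proof.
move=> d0 m0 ml; have := trace_sq_le A d0; have := frobenius_ge0 A.
have := sqr_ge0 (\tr A).
have D0 : 0 < d%:R :> R by rewrite ltr0n.
move: (frobenius A A) (\tr A ^+ 2) => F T T0 F0 TF.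
have [l0|l0] := leP 0 l; first by exists (2 * m); [lra|nra].
by exists (2 * m + d%:R * l) => //; nra.
Qed.

End tensors.

Section forms.
Context (R : realType) (d : nat).
Local Notation pt := 'cV[R]_d.
Context (Omega : set pt) (G : fracture_network R d) (M : mesh R d).
Context (wF : face M -> node M -> R) (wC : cell M -> node M -> R).
Implicit Types (K L : cell M) (s : face M) (a : node M) (u v w : dofs M) (k : R).

Lemma dofsE1 k u v i : (k *: u + v).1 i = k *: u.1 i + v.1 i.
Proof. by rewrite !ffunE. Qed.

Lemma dofsE2 k u v i : (k *: u + v).2 i = k *: u.2 i + v.2 i.
Proof. by rewrite !ffunE. Qed.

Lemma face_mean_lin k u v K s :
  face_mean wF (k *: u + v) K s = k *: face_mean wF u K s + face_mean wF v K s.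
Proof.
rewrite /face_mean scaler_sumr -big_split; apply: eq_bigr => a _ /=.
by rewrite dofsE1 scalerDr !scalerA mulrC.
Qed.

Lemma cell_mean_lin k u v K :
  cell_mean wC (k *: u + v) K = k *: cell_mean wC u K + cell_mean wC v K.
Proof.
rewrite /cell_mean scaler_sumr -big_split; apply: eq_bigr => a _ /=.
by rewrite dofsE1 scalerDr !scalerA mulrC.
Qed.

Lemma face_jump_lin k u v s :
  face_jump wF (k *: u + v) s = k *: face_jump wF u s + face_jump wF v s.
Proof.
rewrite /face_jump !face_mean_lin dofsE2.
by apply/matrixP => i j; rewrite !mxE; ring.
Qed.

Lemma cell_grad_lin k u v K :
  cell_grad G wF (k *: u + v) K = k *: cell_grad G wF u K + cell_grad G wF v K.
Proof.
have dist (c : R) (x y n : pt) :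
    c *: ((k *: x + y) *m n^T) = k *: (c *: (x *m n^T)) + c *: (y *m n^T).
  by rewrite mulmxDl -scalemxAl scalerDr !scalerA mulrC.
rewrite /cell_grad scalerDr addrACA scalerA (mulrC k) -scalerA -scalerDr.
congr (_ *: _ + _); rewrite scaler_sumr -big_split; apply: eq_bigr => s _ /=.
  by rewrite face_mean_lin dist.
by rewrite dofsE2 dist.
Qed.

Lemma cell_recons_lin k u v K x : cell_recons G wF wC (k *: u + v) K x =
  k *: cell_recons G wF wC u K x + cell_recons G wF wC v K x.
Proof.
rewrite /cell_recons cell_grad_lin cell_mean_lin mulmxDl -scalemxAl scalerDr.
by rewrite addrACA.
Qed.

Definition cell_strain v K : 'M[R]_d :=
  2^-1 *: (cell_grad G wF v K + (cell_grad G wF v K)^T).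

Lemma cell_strain_lin k u v K :
  cell_strain (k *: u + v) K = k *: cell_strain u K + cell_strain v K.
Proof.
rewrite /cell_strain cell_grad_lin.
by apply/matrixP => i j; rewrite !mxE; ring.
Qed.

Lemma cell_stabC u v K : cell_stab G wF wC u v K = cell_stab G wF wC v u K.
Proof.
by congr (_ * _ + _ * _); apply: eq_bigr => i _; rewrite dotC.
Qed.

Lemma cell_stab_lin w k u v K : cell_stab G wF wC (k *: u + v) w K =
  k * cell_stab G wF wC u w K + cell_stab G wF wC v w K.
Proof.
rewrite /cell_stab -!mulrDr mulrCA -mulrDr (mulrDr k) addrACA !mulr_sumr -!big_split.
congr (_ * (_ + _)); apply: eq_bigr => i _ /=.
  rewrite dofsE1 cell_recons_lin -dotZl -dotDl; congr dot.
  by rewrite scalerBr opprD addrACA.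
by rewrite dofsE2 -dotZl -dotDl.
Qed.

(** The arguments m and l stand for the integrals of the Lame coefficients over
    the cells, and c for the coefficients of the stabilisation. *)
Definition energy (m l c : cell M -> R) u v : R :=
  \sum_K (2 * m K * frobenius (cell_strain u K) (cell_strain v K) +
          l K * (\tr (cell_strain u K) * \tr (cell_strain v K)) +
          c K * cell_stab G wF wC u v K).

Lemma energyC m l c u v : energy m l c u v = energy m l c v u.
Proof.
apply: eq_bigr => K _; rewrite frobeniusC (mulrC (\tr _)).
by rewrite cell_stabC.
Qed.

Lemma energy_lin m l c w k u v :
  energy m l c (k *: u + v) w = k * energy m l c u w + energy m l c v w.
Proof.
rewrite /energy mulr_sumr -big_split; apply: eq_bigr => K _ /=.
rewrite cell_stab_lin cell_strain_lin frobeniusDl frobeniusZl mxtraceD mxtraceZ.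
ring.
Qed.

Lemma in_U0_0 : @in_U0 _ _ Omega G M 0.
Proof. by split=> *; rewrite !ffunE. Qed.

Lemma in_U0_lin k u v : in_U0 Omega G u -> in_U0 Omega G v ->
  in_U0 Omega G (k *: u + v).
Proof.
move=> [u1 u2 u3 u4] [v1 v2 v3 v4]; split=> [K a Ka|K s Ks|K a Ka Oa|K L a Ka La KL].
- by rewrite dofsE1 u1// v1// scaler0 addr0.
- by rewrite dofsE2 u2// v2// scaler0 addr0.
- by rewrite dofsE1 u3// v3// scaler0 addr0.
- by rewrite !dofsE1 (u4 K L)// (v4 K L).
Qed.

End forms.

Section definiteness.
Context (R : realType) (d : nat) (hd : d = 2%N \/ d = 3%N).
Local Notation pt := 'cV[R]_d.
Context (Omega : set pt) (G : fracture_network R d) (M : mesh R d).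
Hypothesis hOmega : polytopal_domain d setT Omega.
Hypothesis hG : is_fracture_network Omega G.
Hypothesis hM : is_conforming_mesh Omega G M.
Context (wF : face M -> node M -> R) (wC : cell M -> node M -> R).
Implicit Types (K L : cell M) (s : face M) (a : node M) (u v w : dofs M).

(** In each cell the displacement is a rigid motion. It is zero in a cell with a
    face on the boundary of the domain, and this propagates through the faces
    off the network. *)
Lemma rigid_displacement_eq0 v : in_U0 Omega G v ->
  (forall K, cell_strain G wF v K = 0) ->
  (forall K a, a \in cell_nodes K -> v.1 (K, a) = cell_recons G wF wC v K (pos a)) ->
  (forall K s, s \in plus_fracture_faces G K -> v.2 (K, s) = 0) -> v = 0.
Proof.
move=> [v1 v2 v3 v4] eps0 stab1 stab2.
pose P K := cell_grad G wF v K = 0 /\ cell_mean wC v K = 0.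
have P_face K s : s \in cell_faces K ->
    (forall a, a \in face_nodes s -> v.1 (K, a) = 0) -> P K.
  move=> sK va; apply: (rigid_motion_face_eq0 (x0 := cell_center K) hd hM (s := s)).
    apply/eqP; rewrite -addr_eq0 addrC; apply/eqP.
    have /eqP := eps0 K; rewrite /cell_strain scaler_eq0 invr_eq0 pnatr_eq0 /=.
    by move/eqP.
  move=> a sa; have aK := face_nodes_cell_nodes sK sa.
  by rewrite -/(cell_recons G wF wC v K (pos a)) -stab1// va.
have P_nodes K a : P K -> a \in cell_nodes K -> v.1 (K, a) = 0.
  move=> [g0 m0] aK; rewrite stab1// /cell_recons g0 m0.
  by rewrite mul0mx addr0.
have Pall K : P K.
  have [s sO [K0 sK0]] := boundary_face_exists hd hOmega hM.
  apply: (cells_connected hd hOmega hG hM (P := P)) (_ : P K0).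
    move=> s' K1 K2 sF sK1 sK2 PK1.
    have [<-//|K12] := eqVneq K1 K2.
    apply: (P_face K2 s') => // a sa.
    have aK1 := face_nodes_cell_nodes sK1 sa.
    have aK2 := face_nodes_cell_nodes sK2 sa.
    rewrite -(v4 K1 K2)//; first exact: P_nodes.
    exact: (same_side_face hd hOmega hM sF K12 sK1 sK2 sa).
  apply: (P_face K0 s) => // a sa; apply: v3.
    exact: face_nodes_cell_nodes sK0 sa.
  exact: boundary_face_nodes sO sa.
apply/eqP; rewrite -pair_eqE /=; apply/andP; split; apply/eqP/ffunP => -[K i].
  rewrite ffunE; have [iK|iK] := boolP (i \in cell_nodes K); last exact: v1.
  exact: P_nodes.
rewrite ffunE; have [iK|iK] := boolP (i \in plus_fracture_faces G K); last exact: v2.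
exact: stab2.
Qed.

Lemma stab_scaling_gt0 K : 0 < diam (cell_set K) ^+ (d - 2).
Proof.
rewrite exprn_gt0//; have d0 : (0 < d)%N by case: hd => ->.
apply: diam_gt0 => //; first exact: cell_open hM K.
  exact: polytopal_nonempty (cell_polyhedral hM K).
exact: polytopal_bounded_set (cell_polyhedral hM K).
Qed.

Lemma cell_stab_ge0 v K : 0 <= cell_stab G wF wC v v K.
Proof.
have h0 := ltW (stab_scaling_gt0 K).
by apply: addr_ge0; apply: mulr_ge0 => //; apply: sumr_ge0 => i _; exact: dot_ge0.
Qed.

Lemma cell_stab_eq0 v K : cell_stab G wF wC v v K = 0 ->
  (forall a, a \in cell_nodes K -> v.1 (K, a) = cell_recons G wF wC v K (pos a)) /\
  (forall s, s \in plus_fracture_faces G K -> v.2 (K, s) = 0).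
Proof.
have h0 := stab_scaling_gt0 K.
have sum0 (I : finType) (D : pred I) (F : I -> pt) :
    0 <= \sum_(i | D i) dot (F i) (F i).
  by apply: sumr_ge0 => i _; exact: dot_ge0.
have sumz (I : finType) (D : pred I) (F : I -> pt) :
    \sum_(i | D i) dot (F i) (F i) = 0 -> forall i, D i -> F i = 0.
  move=> /psumr_eq0P F0 i Di; apply: dot_eq0; apply: F0 => // j _; exact: dot_ge0.
rewrite /cell_stab -mulrDr => /eqP; rewrite mulf_eq0 gt_eqF//=.
rewrite paddr_eq0 ?sum0// => /andP[/eqP/sumz h1 /eqP/sumz h2]; split=> [a aK|s sK].
  by apply/eqP; rewrite -subr_eq0; apply/eqP; exact: h1.
exact: h2.
Qed.

Lemma energy_definite (m l c : cell M -> R) v : in_U0 Omega G v ->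
  (forall K, 0 < m K) -> (forall K, 0 < 2 * m K + d%:R * l K) ->
  (forall K, 0 < c K) ->
  0 <= energy G wF wC m l c v v /\ (energy G wF wC m l c v v = 0 -> v = 0).
Proof.
move=> vU m0 l0 c0; have d0 : (0 < d)%N by case: hd => ->.
have cell0 K : 0 <= 2 * m K * frobenius (cell_strain G wF v K) (cell_strain G wF v K) +
          l K * (\tr (cell_strain G wF v K) * \tr (cell_strain G wF v K)) +
          c K * cell_stab G wF wC v v K /\
   (2 * m K * frobenius (cell_strain G wF v K) (cell_strain G wF v K) +
          l K * (\tr (cell_strain G wF v K) * \tr (cell_strain G wF v K)) +
          c K * cell_stab G wF wC v v K = 0 ->
    frobenius (cell_strain G wF v K) (cell_strain G wF v K) = 0 /\
    cell_stab G wF wC v v K = 0).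
  have [k k0] := lame_form_ge (cell_strain G wF v K) d0 (m0 K) (l0 K).
  rewrite -expr2; have := frobenius_ge0 (cell_strain G wF v K).
  have := cell_stab_ge0 v K; have := c0 K.
  move: (frobenius _ _) (cell_stab _ _ _ _ _ _) (_ ^+ 2) => F S T C0 S0 F0 kF.
  have kF0 : 0 <= k * F by rewrite mulr_ge0// ltW.
  have CS0 : 0 <= c K * S by rewrite mulr_ge0// ltW.
  split; first by lra.
  move=> e0; have /eqP : k * F = 0 by lra.
  have /eqP : c K * S = 0 by lra.
  by rewrite !mulf_eq0 (gt_eqF k0) (gt_eqF C0) => /eqP-> /eqP->.
split; first by apply: sumr_ge0 => K _; have [] := cell0 K.
move=> /psumr_eq0P e0.
have {}e0 K := (cell0 K).2 (e0 (fun K _ => (cell0 K).1) K erefl).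
apply: rigid_displacement_eq0 => // K.
- by apply: frobenius_eq0; have [] := e0 K.
- by move=> a aK; have [_ /cell_stab_eq0[h _]] := e0 K; exact: h.
- by move=> s sK; have [_ /cell_stab_eq0[_ h]] := e0 K; exact: h.
Qed.

End definiteness.

(** * The terms of the scheme as finite sums *)

Section integrals.
Context (R : realType) (d : nat) (hd : d = 2%N \/ d = 3%N).
Local Notation pt := 'cV[R]_d.
Context (Omega : set pt) (G : fracture_network R d) (M : mesh R d).
Hypothesis hOmega : polytopal_domain d setT Omega.
Hypothesis hG : is_fracture_network Omega G.
Hypothesis hM : is_conforming_mesh Omega G M.
Context (wF : face M -> node M -> R) (wC : cell M -> node M -> R).
Implicit Types (K L : cell M) (s : face M) (a : node M) (u v w : dofs M).

Lemma domain_measurable : measurable Omega.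
Proof. apply: polytopal_measurable hOmega; exact: closedT. Qed.

Lemma cell_measurable K : measurable (cell_set K).
Proof. apply: polytopal_measurable (cell_polyhedral hM K); exact: closedT. Qed.

Lemma domainI_cell K : Omega `&` cell_set K = cell_set K.
Proof. by apply: setIidr; exact: (cell_sub hM). Qed.

Lemma volume_gt0 K : 0 < volume K.
Proof.
apply: fine_gt0; apply/andP; split.
  exact: domain_lebn_gt0 (cell_polyhedral hM K).
exact: domain_lebn_fin (cell_polyhedral hM K).
Qed.

Section lame.
Context (mu lambda : pt -> R) (hlame : are_lame_coefficients Omega mu lambda).

Lemma lame_integrable K :
  (@lebn R d).-integrable (cell_set K) (EFin \o mu) /\
  (@lebn R d).-integrable (cell_set K) (EFin \o lambda).
Proof.
have [B hB] := lame_bounded hlame.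
have bnd (phi : pt -> R) : (forall x, Omega x -> `|phi x| <= B) ->
    measurable_fun Omega phi ->
    (@lebn R d).-integrable (cell_set K) (EFin \o phi).
  move=> phiB mphi.
  apply: (integrableS domain_measurable (cell_measurable K) (cell_sub hM (K := K))).
  apply: measurable_bounded_integrable => //; first exact: domain_measurable.
    exact: domain_lebn_fin hOmega.
  exists B; split; first exact: num_real.
  by move=> r Br x Ox /=; apply: (le_trans (phiB _ Ox)); exact: ltW.
split; apply: bnd.
- by move=> x /hB[].
- exact: mu_measurable hlame.
- by move=> x /hB[].
- exact: lambda_measurable hlame.
Qed.

Let mK K := \int[@lebn R d]_(x in cell_set K) mu x.
Let lK K := \int[@lebn R d]_(x in cell_set K) lambda x.

(** Integrated over a cell, the pointwise coercivity bounds keep a positive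
    constant times the volume. *)
Lemma lame_integral_gt0 K : 0 < mK K /\ 0 < 2 * mK K + d%:R * lK K.
Proof.
have [c [c0 hc]] := lame_coercive hlame.
have [imu ilam] := lame_integrable K.
have mC := cell_measurable K.
have cC : (@lebn R d).-integrable (cell_set K) (EFin \o cst c).
  apply: cst_integrable => //; exact: domain_lebn_fin (cell_polyhedral hM K).
have cv0 : 0 < c * volume K by rewrite mulr_gt0// volume_gt0.
have cvE : \int[@lebn R d]_(x in cell_set K) c = c * volume K by exact: Rintegral_cst.
have i2 : (@lebn R d).-integrable (cell_set K) (EFin \o (fun x => mu x * 2)).
  exact: (integrableZr mC 2 imu).
have id : (@lebn R d).-integrable (cell_set K) (EFin \o (fun x => lambda x * d%:R)).
  exact: (integrableZr mC d%:R ilam).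
split; apply: (lt_le_trans cv0); rewrite -cvE.
  by apply: le_Rintegral => // x /(cell_sub hM)/hc[].
rewrite (mulrC 2) (mulrC d%:R) -!RintegralZr// -RintegralD//.
apply: le_Rintegral => //.
  by have := integrableD mC i2 id; apply: eq_integrable => // x _; rewrite /= EFinD.
move=> x /(cell_sub hM)/hc[_]; by rewrite mulrC (mulrC d%:R).
Qed.

Lemma stress_integral u v :
  \int[@lebn R d]_(x in Omega)
     frobenius (stressD G wF mu lambda u x) (strainD G wF v x) =
  \sum_K (2 * mK K * frobenius (cell_strain G wF u K) (cell_strain G wF v K) +
          lK K * (\tr (cell_strain G wF u K) * \tr (cell_strain G wF v K))).
Proof.
pose F K := frobenius (cell_strain G wF u K) (cell_strain G wF v K).
pose T K := \tr (cell_strain G wF u K) * \tr (cell_strain G wF v K).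
have i1 K : (@lebn R d).-integrable (cell_set K) (EFin \o (fun x => mu x * (2 * F K))).
  exact: (integrableZr (cell_measurable K) (2 * F K) (lame_integrable K).1).
have i2 K : (@lebn R d).-integrable (cell_set K) (EFin \o (fun x => lambda x * T K)).
  exact: (integrableZr (cell_measurable K) (T K) (lame_integrable K).2).
rewrite (Rintegral_pieces (E := @cell_set _ _ M)
  (h := fun K x => mu x * (2 * F K) + lambda x * T K)).
- apply: eq_bigr => K _; rewrite domainI_cell RintegralD//; last exact: cell_measurable.
  rewrite !RintegralZr//; first by rewrite -/(mK K) -/(lK K) /F /T; ring.
  + exact: cell_measurable.
  + exact: (lame_integrable K).2.
  + exact: cell_measurable.
  + exact: (lame_integrable K).1.
- exact: domain_measurable.
- exact: cell_measurable.
- exact: (cell_disjoint hM).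
- move=> K; rewrite domainI_cell.
  by have := integrableD (cell_measurable K) (i1 K) (i2 K);
     apply: eq_integrable => //; exact: cell_measurable.
- move=> K x _ Kx.
  have strainE z : strainD G wF z x = cell_strain G wF z K.
    by rewrite /strainD /gradD (piecewise_in _ (cell_disjoint hM) Kx).
  rewrite /stressD /divD !strainE frobeniusDl frobeniusZl frobenius_scalar_mx.
  by rewrite /F /T; ring.
- move=> x _ nx; have strainE z : strainD G wF z x = 0.
    by rewrite /strainD /gradD piecewise_out// trmx0 addr0 scaler0.
  by rewrite strainE frobeniusC -(scale0r 0) frobeniusZl mul0r.
Qed.

Lemma energy_integral u v :
  \int[@lebn R d]_(x in Omega)
     frobenius (stressD G wF mu lambda u x) (strainD G wF v x)
    + stabD G wF wC mu lambda u v =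
  energy G wF wC mK lK (fun K => 2 * cell_average mu K + cell_average lambda K) u v.
Proof. by rewrite stress_integral /stabD -big_split. Qed.

(** If the integral l of lambda is negative, then 2 m + l is at least 2 m + d l. *)
Lemma stab_coefficient_gt0 K : 0 < 2 * cell_average mu K + cell_average lambda K.
Proof.
have d1 : 1 <= d%:R :> R by rewrite ler1n; case: hd => ->.
have [m0 l0] := lame_integral_gt0 K; rewrite /cell_average mulrCA -mulrDr.
rewrite mulr_gt0 ?invr_gt0 ?volume_gt0// -/(mK K) -/(lK K).
by have [lK0|lK0] := leP 0 (lK K); nra.
Qed.

End lame.

Section load.
Context (f : pt -> pt) (hf : is_L2_field Omega f).

(** On a set of finite measure f is integrable because |y| <= 1 + y^2. *)
Lemma load_integrable K (c : pt) :
  (@lebn R d).-integrable (cell_set K) (EFin \o (fun x => dot (f x) c)).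
Proof.
have mC := cell_measurable K.
have fi i : (@lebn R d).-integrable (cell_set K) (EFin \o (fun x => f x i 0)).
  apply: (integrableS domain_measurable mC (cell_sub hM (K := K))).
  have [mf if2] := hf i.
  have ig : (@lebn R d).-integrable Omega
      ((EFin \o cst 1%R) \+ (fun x => ((f x i 0) ^+ 2)%:E))%E.
    apply: integrableD => //; first exact: domain_measurable.
    apply: cst_integrable; [exact: domain_measurable|exact: domain_lebn_fin hOmega].
  apply: (le_integrable domain_measurable _ _ ig).
    exact/measurable_EFinP.
  move=> x _; rewrite /= lee_fin [leRHS]ger0_norm ?addr_ge0 ?sqr_ge0//.
  rewrite -[_ ^+ 2]real_normK ?num_real//; have := sqr_ge0 (`|f x i 0| - 1); nra.
have := @integrable_sum _ _ _ (@lebn R d) _ mC _ (index_enum 'I_d) xpredT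
  (fun i x => (f x i 0 * c i 0)%:E) (fun i _ => integrableZr mC (c i 0) (fi i)).
by apply: eq_integrable => // x _; rewrite /= /dot sumEFin.
Qed.

Let fK K (c : pt) := \int[@lebn R d]_(x in cell_set K) dot (f x) c.

Lemma load_lin K k (b c : pt) : fK K (k *: b + c) = k * fK K b + fK K c.
Proof.
have mC := cell_measurable K.
rewrite /fK -RintegralZl//; last exact: load_integrable.
rewrite -RintegralD//; last exact: load_integrable.
  by apply: eq_Rintegral => x _; rewrite dotDr dotZr.
by have := integrableZl mC k (load_integrable K b); apply: eq_integrable.
Qed.

Lemma load_integral v :
  \int[@lebn R d]_(x in Omega) dot (f x) (reconsD wC v x) =
  \sum_K fK K (cell_mean wC v K).
Proof.
rewrite (Rintegral_pieces (E := @cell_set _ _ M)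
  (h := fun K x => dot (f x) (cell_mean wC v K))).
- by apply: eq_bigr => K _; rewrite domainI_cell.
- exact: domain_measurable.
- exact: cell_measurable.
- exact: (cell_disjoint hM).
- by move=> K; rewrite domainI_cell; exact: load_integrable.
- by move=> K x _ Kx; rewrite /reconsD (piecewise_in _ (cell_disjoint hM) Kx).
- by move=> x _ nx; rewrite /reconsD piecewise_out// dotr0.
Qed.

End load.

Lemma face_measurable s : measurable (face_set s).
Proof. apply: polytopal_measurable (face_planar hM s); exact: hyperplane_closed. Qed.

Lemma fracture_measurable i : measurable (@fracture _ _ G i).
Proof. apply: polytopal_measurable (fracture_polygonal hG i); exact: hyperplane_closed. Qed.

(** The part of the measure of a face that the integrals over the fractures see,
    each with the surface measure of its own plane; it vanishes for a face that
    meets no fracture. *)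
Definition face_weight s : R :=
  \sum_i fine (surface (fracture_normal i) (fracture_offset i)
                 (@fracture _ _ G i `&` face_set s)).

Lemma fracture_face_fin i s : (surface (fracture_normal i) (fracture_offset i)
  (@fracture _ _ G i `&` face_set s) < +oo)%E.
Proof.
apply: surface_fin.
  by apply: measurableI; [exact: fracture_measurable|exact: face_measurable].
have [B [Br fB]] := polytopal_bounded_set (fracture_polygonal hG i).
by exists B; split=> // r Br' x [fx _]; exact: fB Br' x fx.
Qed.

Lemma network_integral_pieces (F : pt -> R) (r : face M -> R) :
  (forall s x, face_set s x -> F x = r s) ->
  (forall x, (forall s, ~ face_set s x) -> F x = 0) ->
  network_integral G F = \sum_s face_weight s * r s.
Proof.
move=> Fr F0; rewrite /network_integral.
transitivity (\sum_i \sum_s fine (surface (fracture_normal i) (fracture_offset i)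
                 (@fracture _ _ G i `&` face_set s)) * r s); last first.
  by rewrite exchange_big; apply: eq_bigr => s _; rewrite mulr_suml.
apply: eq_bigr => i _.
rewrite (Rintegral_pieces (E := @face_set _ _ M) (h := fun s => cst (r s))).
- apply: eq_bigr => s _; rewrite mulrC; apply: Rintegral_cst.
  by apply: measurableI; [exact: fracture_measurable|exact: face_measurable].
- exact: fracture_measurable.
- exact: face_measurable.
- exact: (face_disjoint hM).
- move=> s; apply: cst_integrable; last exact: fracture_face_fin.
  by apply: measurableI; [exact: fracture_measurable|exact: face_measurable].
- by move=> s x _; exact: Fr.
- by move=> x _; exact: F0.
Qed.

(** The integral over the fracture uses the plane of the fracture, while the
    face is relatively open in its own plane. The two planes coincide: the
    fracture contains the face, hence small displacements along the plane of
    the face. *)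
Lemma face_weight_gt0 s : s \in fracture_faces M -> 0 < face_weight s.
Proof.
move=> sF; have [i si] := fracture_face hM sF.
rewrite /face_weight (bigD1 i)//= ltr_pwDl//; last first.
  by apply: sumr_ge0 => j _; exact: fine_ge0.
apply: fine_gt0; rewrite fracture_face_fin andbT.
set nu := fracture_normal i; set c := fracture_offset i.
pose n := face_normal s.
have n1 := dot_unit (face_normal_unit hM s).
have nu1 := dot_unit (fracture_normal_unit hG i).
have [x0 sx0] := polytopal_nonempty (face_planar hM s).
have [V _ fV] := polytopal_relopen (fracture_polygonal hG i).
have onH x : face_set s x -> dot nu x = c by move=> /si; rewrite fV => -[].
have [U oU sU] := face_relopen hM s.
have nE : nu = dot n nu *: n.
  pose e := nu - dot n nu *: n.
  have ne : dot n e = 0 by rewrite dotBr dotZr n1 mulr1 subrr.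
  have [t t0 st] := open_along_step (@face_open_along _ _ _ _ _ hM s) sx0 ne.
  have nue : dot nu e = 0.
    have := onH _ st; rewrite dotDr dotZr (onH _ sx0) => /eqP.
    by rewrite -subr_eq0 addrAC subrr add0r mulf_eq0 gt_eqF//= => /eqP.
  apply/eqP; rewrite -subr_eq0; apply/eqP/dot_eq0.
  by rewrite {1}dotBl dotZl nue ne mulr0 subr0.
have k0 : dot n nu != 0.
  by apply/eqP => k0; move: nu1; rewrite -/nu nE k0 scale0r dot0r => /eqP; rewrite eq_sym oner_eq0.
have [Hx0 Ux0] : (hyperplane n (face_offset s) `&` U) x0 by rewrite -sU.
have hyp x : dot nu x = c -> dot n x = face_offset s.
  move=> nux; have : dot nu (x - x0) = 0 by rewrite dotBr nux (onH _ sx0) subrr.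
  rewrite nE dotZl => /eqP; rewrite mulf_eq0 (negbTE k0)/= dotBr subr_eq0 => /eqP->.
  exact: Hx0.
apply: (surface_gt0 (U := U)) => //.
- exact: fracture_normal_unit hG i.
- by apply: measurableI; [exact: fracture_measurable|exact: face_measurable].
- by exists x0; split=> //; exact: onH.
- move=> x [Hx Ux]; have sx : face_set s x by rewrite sU; split=> //; exact: hyp.
  by split=> //; exact: si.
Qed.

Lemma nplus_unit s : s \in fracture_faces M -> dot (nplus G s) (nplus G s) = 1.
Proof.
move=> sF; rewrite /nplus; case: pickP => [i _|]; last first.
  by have [i si] := fracture_face hM sF; move=> /(_ i)/asboolP.
exact: dot_unit (fracture_normal_unit hG i).
Qed.

Lemma plus_cell_face s : s \in fracture_faces M ->
  s \in plus_fracture_faces G (plus_cell s).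
Proof.
move=> sF; have [cells _ out _] := fracture_face_sides hM sF.
rewrite finset.in_set sF out nplus_unit// ltr01 andbT /=.
have : plus_cell s \in face_cells s by rewrite cells set21.
by rewrite finset.in_set.
Qed.

Definition bubble s (z : pt) : dofs M :=
  ([ffun=> 0], [ffun p => if p == (plus_cell s, s) then z else 0]).

Lemma bubble_U0 s z : s \in fracture_faces M -> in_U0 Omega G (bubble s z).
Proof.
move=> sF; split=> [K a _|K t Kt|K a _ _|K L a _ _ _]; rewrite ?ffunE//=.
by case: eqP => // -[KE tE]; move: Kt; rewrite KE tE plus_cell_face.
Qed.

Lemma bubble_jump s z t : face_jump wF (bubble s z) t = if t == s then z else 0.
Proof.
have mean0 K t' : face_mean wF (bubble s z) K t' = 0.
  by rewrite /face_mean big1// => a _; rewrite ffunE scaler0.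
rewrite /face_jump !mean0 subrr add0r ffunE xpair_eqE.
by have [->|] := eqVneq t s; rewrite ?eqxx// andbF.
Qed.

Definition coupling (q : multipliers M) v : R :=
  \sum_s face_weight s * dot (q s) (face_jump wF v s).

Lemma coupling_linl v k (p q : multipliers M) :
  coupling (k *: p + q) v = k * coupling p v + coupling q v.
Proof.
rewrite /coupling mulr_sumr -big_split; apply: eq_bigr => s _ /=.
by rewrite !ffunE dotDl dotZl; ring.
Qed.

Lemma coupling_linr (q : multipliers M) k u v :
  coupling q (k *: u + v) = k * coupling q u + coupling q v.
Proof.
rewrite /coupling mulr_sumr -big_split; apply: eq_bigr => s _ /=.
by rewrite face_jump_lin dotDr dotZr; ring.
Qed.

(** Test with the bubble on s whose value is q s itself. *)
Lemma coupling_inj (q : multipliers M) : in_MD q ->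
  (forall v, in_U0 Omega G v -> coupling q v = 0) -> q = 0.
Proof.
move=> qM q0; apply/ffunP => s; rewrite ffunE.
have [sF|/qM//] := boolP (s \in fracture_faces M).
have := q0 _ (bubble_U0 (q s) sF).
rewrite /coupling (bigD1 s)//= big1 ?addr0 => [|t ts]; last first.
  by rewrite bubble_jump (negbTE ts) dotr0 mulr0.
rewrite bubble_jump eqxx => /eqP; rewrite mulf_eq0 gt_eqF ?face_weight_gt0//=.
by move=> /eqP/dot_eq0.
Qed.

Lemma coupling_integral (q : multipliers M) v :
  network_integral G (fun x => dot (multD q x) (jumpD wF v x)) = coupling q v.
Proof.
apply: network_integral_pieces => [s x sx|x nx]; rewrite /multD /jumpD.
  by rewrite !(piecewise_in _ (face_disjoint hM) sx).
by rewrite !piecewise_out// dotr0.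
Qed.

Lemma coupling_integralB (q q' : multipliers M) v :
  network_integral G (fun x => dot (multD q' x - multD q x) (jumpD wF v x)) =
  coupling (q' - q) v.
Proof.
apply: network_integral_pieces => [s x sx|x nx]; rewrite /multD /jumpD.
  by rewrite !(piecewise_in _ (face_disjoint hM) sx) !ffunE.
by rewrite !piecewise_out// dotr0.
Qed.

End integrals.

(** * The convex set of multipliers *)

Section multiplier_set.
Context (R : realType) (d : nat).
Local Notation pt := 'cV[R]_d.
Context (G : fracture_network R d) (M : mesh R d) (g : face M -> R).
Hypothesis g0 : forall s, s \in fracture_faces M -> 0 <= g s.
Implicit Types (p q : multipliers M) (s : face M).

Lemma enorm_le (x : pt) (r : R) : 0 <= r -> (enorm x <= r) = (dot x x <= r ^+ 2).
Proof.
move=> r0; rewrite -(sqr_sqrtr (dot_ge0 x)) -/(enorm x) ler_pXn2r ?nnegrE//.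
exact: sqrtr_ge0.
Qed.

Lemma in_MD_lin k p q : in_MD p -> in_MD q -> in_MD (k *: p + q).
Proof. by move=> pM qM s sF; rewrite !ffunE pM// qM// scaler0 addr0. Qed.

Lemma normal_part_lin k p q s :
  normal_part G (k *: p + q) s = k * normal_part G p s + normal_part G q s.
Proof. by rewrite /normal_part !ffunE dotDl dotZl. Qed.

Lemma tangential_part_lin k p q s : tangential_part G (k *: p + q) s =
  k *: tangential_part G p s + tangential_part G q s.
Proof.
rewrite /tangential_part normal_part_lin !ffunE.
by apply/matrixP => i j; rewrite !mxE; ring.
Qed.

Lemma in_CD0 : @in_CD _ _ G M g 0.
Proof.
split=> [s _|s sF]; first by rewrite ffunE.
have n0 : normal_part G 0 s = 0 by rewrite /normal_part ffunE dot0r.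
split; first by rewrite n0.
rewrite enorm_le ?g0// /tangential_part n0 ffunE scale0r subr0 dotr0.
exact: sqr_ge0.
Qed.

Lemma in_CD_convex p q (t : R) : 0 <= t <= 1 -> in_CD G g p -> in_CD G g q ->
  in_CD G g (p + t *: (q - p)).
Proof.
move=> /andP[t0 t1] [pM pC] [qM qC].
have -> : p + t *: (q - p) = (1 - t) *: p + t *: q.
  by rewrite scalerBl scalerBr scale1r addrA addrAC.
split=> [s sF|s sF]; first by rewrite !ffunE pM// qM// !scaler0 addr0.
have [pn pt'] := pC s sF; have [qn qt] := qC s sF.
have tE : t *: q = t *: q + 0 by rewrite addr0.
have nq : normal_part G (t *: q) s = t * normal_part G q s.
  by rewrite tE normal_part_lin /normal_part ffunE dot0r addr0.
split; first by rewrite normal_part_lin nq; nra.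
rewrite tangential_part_lin.
have -> : tangential_part G (t *: q) s = t *: tangential_part G q s.
  by rewrite /tangential_part nq ffunE scalerBr scalerA.
move: pt' qt; rewrite !enorm_le ?g0//.
move: (tangential_part G p s) (tangential_part G q s) => x y xg yg.
have := dot_ge0 (x - y).
rewrite dotBl !dotBr dotDl !dotDr !dotZl !dotZr (dotC y x).
move: (dot x x) (dot x y) (dot y y) xg yg => xx xy yy xg yg h.
have h' : 0 <= (1 - t) * t * (xx - xy - (xy - yy)) by rewrite !mulr_ge0// subr_ge0.
nra.
Qed.

(** The bound on the tangential part is squared to avoid the square root: both
    constraints are then polynomial in the coordinates. *)
Lemma in_CD_closed n (e : 'I_n -> multipliers M) :
  closed [set x : 'rV[R]_n | in_CD G g (\sum_i x 0 i *: e i)].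
Proof.
pose q (x : 'rV[R]_n) : multipliers M := \sum_i x 0 i *: e i.
have cq s j : continuous (fun x : 'rV[R]_n => q x s j 0).
  rewrite (_ : (fun _ => _) = fun x : 'rV[R]_n => \sum_i x 0 i * e i s j 0).
    apply: continuous_sum => i x; apply: (@continuousM R 'rV[R]_n (fun x : 'rV[R]_n => x 0 i)).
      exact: coord_continuous.
    exact: cst_continuous.
  apply/funext => x; rewrite /q sum_ffunE summxE.
  by apply: eq_bigr => i _; rewrite ffunE mxE.
have cn s : continuous (fun x : 'rV[R]_n => normal_part G (q x) s).
  apply: continuous_sum => j x.
  apply: (@continuousM R 'rV[R]_n (fun x : 'rV[R]_n => q x s j 0)); first exact: cq.
  exact: cst_continuous.
have ct s : continuous (fun x : 'rV[R]_n =>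
    dot (tangential_part G (q x) s) (tangential_part G (q x) s)).
  have cj j : continuous (fun x : 'rV[R]_n => tangential_part G (q x) s j 0).
    rewrite (_ : (fun _ => _) = fun x : 'rV[R]_n =>
        q x s j 0 - normal_part G (q x) s * nplus G s j 0); last first.
      by apply/funext => x; rewrite !mxE.
    move=> x; apply: (@continuousB _ _ _ (fun x : 'rV[R]_n => q x s j 0)); first exact: cq.
    apply: (@continuousM R 'rV[R]_n (fun x : 'rV[R]_n => normal_part G (q x) s)).
      exact: cn.
    exact: cst_continuous.
  apply: continuous_sum => j x.
  by apply: (@continuousM R 'rV[R]_n (fun x : 'rV[R]_n => tangential_part G (q x) s j 0));
    exact: cj.
have pre (phi : 'rV[R]_n -> R) (A : set R) : continuous phi -> closed A ->
    closed (phi @^-1` A).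
  by move=> cphi; apply: preimage_closed => x _; exact: cphi.
have -> : [set x : 'rV[R]_n | in_CD G g (\sum_i x 0 i *: e i)] =
    \bigcap_s [set x | (s \notin fracture_faces M -> forall j, q x s j 0 = 0) /\
      (s \in fracture_faces M -> 0 <= normal_part G (q x) s /\
       dot (tangential_part G (q x) s) (tangential_part G (q x) s) <= g s ^+ 2)].
  apply/seteqP; split=> x.
    move=> [xM xC] s _; split=> [/xM xs j|sF]; first by rewrite /q xs mxE.
    by have [xn xt] := xC s sF; rewrite -enorm_le ?g0.
  move=> xs; split=> s sF.
    by apply/colP => j; rewrite mxE; exact: (xs s I).1.
  by have [xn xt] := (xs s I).2 sF; rewrite enorm_le ?g0.
apply: closed_bigI => s _.
have [sF|sF] := boolP (s \in fracture_faces M).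
  rewrite (_ : [set x | _] =
      ((fun x => normal_part G (q x) s) @^-1` [set y | 0 <= y]) `&`
      ((fun x => dot (tangential_part G (q x) s) (tangential_part G (q x) s)) @^-1`
       [set y | y <= g s ^+ 2])); last first.
    by apply/seteqP; split=> x /=; [move=> [_ /(_ isT)]|split].
  by apply: closedI; apply: pre => //.
rewrite (_ : [set x | _] = \bigcap_j ((fun x => q x s j 0) @^-1` [set 0])).
  by apply: closed_bigI => j _; apply: pre => //.
apply/seteqP; split=> x /=; first by move=> [/(_ isT) h _] j _; exact: h.
by move=> h; split=> // _ j; exact: h.
Qed.

End multiplier_set.

(** * Existence and uniqueness *)

Theorem proposition4p4 (R : realType) (d : nat) (hd : d = 2%N \/ d = 3%N)
    (Omega : set 'cV[R]_d) (G : fracture_network R d) (M : mesh R d)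
    (hOmega : polytopal_domain d setT Omega)
    (hG : is_fracture_network Omega G)
    (hM : is_conforming_mesh Omega G M)
    (hreg : is_regular_mesh Omega M)
    (wF : face M -> node M -> R) (wC : cell M -> node M -> R)
    (hw : are_weights wF wC)
    (f : 'cV[R]_d -> 'cV[R]_d) (hf : is_L2_field Omega f)
    (mu lambda : 'cV[R]_d -> R) (hlame : are_lame_coefficients Omega mu lambda)
    (g : face M -> R)
    (hg : forall s : face M, s \in fracture_faces M -> 0 <= g s) :
  exists! uq : dofs M * multipliers M,
    [/\ in_U0 Omega G uq.1, in_CD G g uq.2 &
        is_solution Omega G wF wC f mu lambda g uq.1 uq.2].
Proof.
pose mK K := \int[@lebn R d]_(x in cell_set (K : cell M)) mu x.
pose lK K := \int[@lebn R d]_(x in cell_set (K : cell M)) lambda x.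
pose cK (K : cell M) := 2 * cell_average mu K + cell_average lambda K.
pose a := energy G wF wC mK lK cK.
pose b (q : multipliers M) v := coupling G wF q v.
pose l (v : dofs M) :=
  \sum_K \int[@lebn R d]_(x in cell_set K) dot (f x) (cell_mean wC v K).
have aE u v : \int[@lebn R d]_(x in Omega)
     frobenius (stressD G wF mu lambda u x) (strainD G wF v x)
    + stabD G wF wC mu lambda u v = a u v.
  exact: energy_integral.
have bE q v : network_integral G (fun x => dot (multD q x) (jumpD wF v x)) = b q v.
  exact: (coupling_integral hG hM).
have bBE q q' v : network_integral G
    (fun x => dot (multD q' x - multD q x) (jumpD wF v x)) = b (q' - q) v.
  exact: (coupling_integralB hG hM).
have lE v : \int[@lebn R d]_(x in Omega) dot (f x) (reconsD wC v x) = l v.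
  exact: (load_integral hOmega hM).
have aL w k u v : a (k *: u + v) w = k * a u w + a v w by exact: energy_lin.
have bL w k p q : b (k *: p + q) w = k * b p w + b q w by exact: coupling_linl.
have bR q k u v : b q (k *: u + v) = k * b q u + b q v by exact: coupling_linr.
have aC u v : a u v = a v u by exact: energyC.
have lL k u v : l (k *: u + v) = k * l u + l v.
  rewrite /l mulr_sumr -big_split; apply: eq_bigr => K _ /=.
  by rewrite cell_mean_lin; exact: (load_lin hOmega hM hf).
have adef v : in_U0 Omega G v -> 0 <= a v v /\ (a v v = 0 -> v = 0).
  move=> vU; apply: (energy_definite hd hOmega hG hM) => // K.
  - exact: (lame_integral_gt0 hOmega hM hlame K).1.
  - exact: (lame_integral_gt0 hOmega hM hlame K).2.
  - exact: (stab_coefficient_gt0 hd hOmega hM hlame K).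
have binj q : in_MD q -> (forall v, in_U0 Omega G v -> b q v = 0) -> q = 0.
  exact: (coupling_inj hG hM).
have MD0 : @in_MD _ _ M 0 by move=> s _; rewrite ffunE.
have [u [q [uU qC uq hq]]] := saddle_point (@in_U0_0 _ _ Omega G M)
  (@in_U0_lin _ _ Omega G M) MD0 (@in_MD_lin _ _ M)
  aC aL bL bR lL (fun v vU => (adef v vU).1) (fun v vU => (adef v vU).2) binj
  (fun q (qC : in_CD G g q) => qC.1) (in_CD0 G hg) (@in_CD_convex _ _ G M g hg)
  (@in_CD_closed _ _ G M g hg).
exists (u, q); split=> [|[u' q'] [/= u'U q'C sol']].
  split=> // v p vU pC; rewrite aE bE lE bBE; split; [exact: uq|exact: hq].
have u'q' v : in_U0 Omega G v -> a u' v + b q' v = l v.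
  by move=> vU; have [] := sol' v q vU qC; rewrite aE bE lE.
have hq' : b (q - q') u' <= 0 by have [_] := sol' u q uU qC; rewrite bBE.
(* The spaces are stable under combinations k *: u + v, so differences are
   written in this form. *)
have BE (p p' : multipliers M) : p - p' = - 1 *: p' + p by rewrite scaleN1r addrC.
have BU (w w' : dofs M) : w - w' = - 1 *: w' + w by rewrite scaleN1r addrC.
have uu'U : in_U0 Omega G (u - u') by rewrite BU; exact: in_U0_lin.
have eq_diff v : in_U0 Omega G v -> a (u - u') v + b (q - q') v = 0.
  by move=> vU; rewrite BU BE aL bL; have := uq v vU; have := u'q' v vU; lra.
have u0 : u - u' = 0.
  have [a0 a00] := adef _ uu'U; apply: a00; apply/eqP; rewrite eq_le a0 andbT.
  have bB p : b p (u - u') = b p u - b p u' by rewrite BU bR; ring.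
  have bN : b (q' - q) u = - b (q - q') u by rewrite !BE !bL; ring.
  have := eq_diff _ uu'U; have := hq q' q'C; have := hq'; rewrite bB bN; lra.
have q0 : q - q' = 0.
  apply: binj => [|v vU].
    by rewrite BE; apply: in_MD_lin; [exact: q'C.1|exact: qC.1].
  have a0 : a 0 v = 0 by have := aL v 1 0 0; rewrite scaler0 addr0; lra.
  by have := eq_diff v vU; rewrite u0 a0 add0r.
by congr pair; apply/eqP; rewrite -subr_eq0 ?u0 ?q0.
Qed.
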